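(* Let $f(q)=q+\sum_{n=2}^{\infty}q^na_n\in\mathcal{S}^{*}$ (with $a_n\in\mathbb{H}$). Then the following inequalities hold for all $q\in\mathbb{B}$: $$\frac{|q|}{1+|a_2q|+|q|^{2}}\leq|f(q)|\leq\frac{|q|}{1-|q|^{2}}\Big(\frac{1+|q|}{1-|q|}\Big)^{\frac{|a_{2}|}{2}};$$ $$\frac{1-|q|^{2}}{(1+|a_2q|+|q|^{2})^{2}}\leq|f'(q)|\leq\frac{1+|a_2q|+|q|^{2}}{(1-|q|^{2})^{2}}\Big(\frac{1+|q|}{1-|q|}\Big)^{\frac{|a_{2}|}{2}};$$ $$\frac{1-|q|^{2}}{1+|a_2q|+|q|^{2}}\leq\frac{|qf'(q)|}{|f(q)|}\leq\frac{1+|a_2q|+|q|^{2}}{1-|q|^{2}}.$$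
   Context: $\mathbb{H}$ denotes the quaternions, $\mathbb{B}=\{q\in\mathbb{H}:|q|<1\}$, $\mathbb{S}=\{q\in\mathbb{H}:q^2=-1\}$; for $I\in\mathbb{S}$, $\mathbb{C}_I=\mathbb{R}\oplus I\mathbb{R}$ and $\mathbb{B}_I=\mathbb{B}\cap\mathbb{C}_I$. A function $f:\mathbb{B}\to\mathbb{H}$ is (left) slice regular if for every $I\in\mathbb{S}$ the restriction $f_I=f|_{\mathbb{B}_I}$ has continuous partial derivatives and $\frac12\left(\frac{\partial}{\partial x}+I\frac{\partial}{\partial y}\right)f_I(x+yI)=0$ on $\mathbb{B}_I$; equivalently $f(q)=\sum_{n\ge0}q^na_n$ on $\mathbb{B}$ with $a_n\in\mathbb{H}$. Its slice derivative is $f'(x+yI)=\frac12\left(\frac{\partial}{\partial x}-I\frac{\partial}{\partial y}\right)f_I(x+yI)$, i.e. $f'(q)=\sum_{n\ge1}q^{n-1}na_n$. $\mathcal{S}$ is the set of slice regular $f:\mathbb{B}\to\mathbb{H}$ whose zero set is $\mathcal{Z}_f=\{0\}$ and with $f'(0)=1$. The class of slice starlike functions $\mathcal{S}^{*}$ is the set of $f\in\mathcal{S}$ such that $\mathrm{Re}\big(f(q)^{-1}qf'(q)\big)>0$ for $q\in\mathbb{B}$ (pointwise products). At $q=0$ the expressions $f(q)^{-1}qf'(q)$ and $|qf'(q)|/|f(q)|$ are understood as their limit value $1$. *)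

(* Defs.v *)
From HB Require Import structures.
From mathcomp Require Import all_boot all_order all_algebra.
From mathcomp Require Import all_classical all_reals all_analysis.
From mathcomp Require Import ring lra.

Set Implicit Arguments.
Unset Strict Implicit.
Unset Printing Implicit Defensive.

Import Order.TTheory GRing.Theory Num.Theory.
Import numFieldNormedType.Exports.

Local Open Scope classical_set_scope.
Local Open Scope ring_scope.

(* [Quat a b c d] is a + b i + c j + d k. *)
Record quat (R : realType) :=
  Quat { quat_re : R; quat_i : R; quat_j : R; quat_k : R }.

Section Structures.
Variable R : realType.
Local Notation H := (quat R).
Implicit Types x y z : H.

Definition quat_to_tuple x := (quat_re x, quat_i x, quat_j x, quat_k x).
Definition quat_of_tuple (t : R * R * R * R) : H :=
  Quat t.1.1.1 t.1.1.2 t.1.2 t.2.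

Lemma quat_to_tupleK : cancel quat_to_tuple quat_of_tuple.
Proof. by case. Qed.

HB.instance Definition _ := Choice.copy H (can_type quat_to_tupleK).

Lemma quatP x y : quat_re x = quat_re y -> quat_i x = quat_i y ->
  quat_j x = quat_j y -> quat_k x = quat_k y -> x = y.
Proof. by case: x y => [? ? ? ?] [? ? ? ?] /= -> -> -> ->. Qed.

Definition quat_add x y : H :=
  Quat (quat_re x + quat_re y) (quat_i x + quat_i y)
       (quat_j x + quat_j y) (quat_k x + quat_k y).

Definition quat_opp x : H :=
  Quat (- quat_re x) (- quat_i x) (- quat_j x) (- quat_k x).

Fact quat_addA : associative quat_add.
Proof. by move=> x y z; apply: quatP; rewrite /= addrA. Qed.

Fact quat_addC : commutative quat_add.
Proof. by move=> x y; apply: quatP; rewrite /= addrC. Qed.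

Fact quat_add0 : left_id (Quat 0 0 0 0) quat_add.
Proof. by move=> x; apply: quatP; rewrite /= add0r. Qed.

Fact quat_addN : left_inverse (Quat 0 0 0 0) quat_opp quat_add.
Proof. by move=> x; apply: quatP; rewrite /= addNr. Qed.

HB.instance Definition _ :=
  GRing.isZmodule.Build H quat_addA quat_addC quat_add0 quat_addN.

Definition quat_mul x y : H :=
  let: Quat a b c d := x in
  let: Quat a' b' c' d' := y in
  Quat (a * a' - b * b' - c * c' - d * d')
       (a * b' + b * a' + c * d' - d * c')
       (a * c' - b * d' + c * a' + d * b')
       (a * d' + b * c' - c * b' + d * a').

Fact quat_mulA : associative quat_mul.
Proof. by move=> [? ? ? ?] [? ? ? ?] [? ? ? ?]; apply: quatP => /=; ring. Qed.

Fact quat_mul1l : left_id (Quat 1 0 0 0) quat_mul.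
Proof. by move=> [? ? ? ?]; apply: quatP => /=; ring. Qed.

Fact quat_mul1r : right_id (Quat 1 0 0 0) quat_mul.
Proof. by move=> [? ? ? ?]; apply: quatP => /=; ring. Qed.

Fact quat_mulDl : left_distributive quat_mul +%R.
Proof. by move=> [? ? ? ?] [? ? ? ?] [? ? ? ?]; apply: quatP => /=; ring. Qed.

Fact quat_mulDr : right_distributive quat_mul +%R.
Proof. by move=> [? ? ? ?] [? ? ? ?] [? ? ? ?]; apply: quatP => /=; ring. Qed.

Fact quat_1neq0 : Quat 1 0 0 0 != 0 :> H.
Proof. by apply/eqP => -[] /eqP; rewrite oner_eq0. Qed.

HB.instance Definition _ := GRing.Zmodule_isNzRing.Build H
  quat_mulA quat_mul1l quat_mul1r quat_mulDl quat_mulDr quat_1neq0.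

Definition quat_scale (a : R) x : H :=
  Quat (a * quat_re x) (a * quat_i x) (a * quat_j x) (a * quat_k x).

Fact quat_scaleA a b x : quat_scale a (quat_scale b x) = quat_scale (a * b) x.
Proof. by apply: quatP; rewrite /= mulrA. Qed.

Fact quat_scale1 : left_id 1 quat_scale.
Proof. by move=> x; apply: quatP; rewrite /= mul1r. Qed.

Fact quat_scaleDr : right_distributive quat_scale +%R.
Proof. by move=> a x y; apply: quatP; rewrite /= mulrDr. Qed.

Fact quat_scaleDl x : {morph quat_scale^~ x : a b / a + b}.
Proof. by move=> a b; apply: quatP; rewrite /= mulrDl. Qed.

HB.instance Definition _ := GRing.Zmodule_isLmodule.Build R H
  quat_scaleA quat_scale1 quat_scaleDr quat_scaleDl.

Fact quat_scaleAl (a : R) x y : a *: (x * y) = (a *: x) * y.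
Proof. by case: x y => [? ? ? ?] [? ? ? ?]; apply: quatP => /=; ring. Qed.

HB.instance Definition _ := GRing.Lmodule_isLalgebra.Build R H quat_scaleAl.

Fact quat_scaleAr (a : R) x y : a *: (x * y) = x * (a *: y).
Proof. by case: x y => [? ? ? ?] [? ? ? ?]; apply: quatP => /=; ring. Qed.

HB.instance Definition _ := GRing.Lalgebra_isAlgebra.Build R H quat_scaleAr.

Definition quat_conj x : H :=
  Quat (quat_re x) (- quat_i x) (- quat_j x) (- quat_k x).

Definition quat_sqnorm x : R :=
  quat_re x ^+ 2 + quat_i x ^+ 2 + quat_j x ^+ 2 + quat_k x ^+ 2.

Lemma quat_sqnorm_ge0 x : 0 <= quat_sqnorm x.
Proof. by rewrite /quat_sqnorm !addr_ge0 ?sqr_ge0. Qed.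

Lemma quat_sqnorm_eq0 x : (quat_sqnorm x == 0) = (x == 0).
Proof.
apply/eqP/eqP => [|->]; last by rewrite /quat_sqnorm /= expr0n /= !addr0.
case: x => a b c d; rewrite /quat_sqnorm /= => h.
by apply: quatP => /=; nra.
Qed.

Definition quat_inv x : H :=
  if x == 0 then x else (quat_sqnorm x)^-1 *: quat_conj x.

Fact quat_mulVr : {in [pred x : H | x != 0], left_inverse 1 quat_inv *%R}.
Proof.
move=> x; rewrite inE => x0; rewrite /quat_inv (negbTE x0) -scalerAl.
move: x0; rewrite -quat_sqnorm_eq0; case: x => a b c d.
by rewrite /quat_sqnorm /= => n0; apply: quatP => /=; field.
Qed.

Fact quat_mulrV : {in [pred x : H | x != 0], right_inverse 1 quat_inv *%R}.
Proof.
move=> x; rewrite inE => x0; rewrite /quat_inv (negbTE x0) -scalerAr.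
move: x0; rewrite -quat_sqnorm_eq0; case: x => a b c d.
by rewrite /quat_sqnorm /= => n0; apply: quatP => /=; field.
Qed.

Fact quat_unitP x y : y * x = 1 /\ x * y = 1 -> x != 0.
Proof.
by case=> yx _; apply/eqP => x0; move: yx; rewrite x0 mulr0 => /esym/eqP;
  rewrite oner_eq0.
Qed.

Fact quat_inv_out : {in [predC [pred x : H | x != 0]], quat_inv =1 id}.
Proof. by move=> x; rewrite !inE negbK /quat_inv => ->. Qed.

HB.instance Definition _ := GRing.NzRing_hasMulInverse.Build H
  quat_mulVr quat_mulrV quat_unitP quat_inv_out.

Definition quat_norm x : R := Num.sqrt (quat_sqnorm x).

Fact quat_normD x y : quat_norm (x + y) <= quat_norm x + quat_norm y.
Proof.
rewrite -(ler_pXn2r (ltn0Sn 1)) ?nnegrE ?addr_ge0 ?sqrtr_ge0 //.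
rewrite sqrrD !sqr_sqrtr ?quat_sqnorm_ge0 //.
set p := quat_norm x * quat_norm y.
have p0 : 0 <= p by rewrite mulr_ge0 ?sqrtr_ge0.
have pE : p ^+ 2 = quat_sqnorm x * quat_sqnorm y.
  by rewrite exprMn !sqr_sqrtr ?quat_sqnorm_ge0.
pose s := quat_re x * quat_re y + quat_i x * quat_i y
        + quat_j x * quat_j y + quat_k x * quat_k y.
have -> : quat_sqnorm (x + y) = quat_sqnorm x + quat_sqnorm y + s *+ 2.
  by rewrite /quat_sqnorm /s /=; ring.
suff : s <= p by rewrite !mulr2n; lra.
apply: le_trans (ler_norm s) _.
rewrite -(ler_pXn2r (ltn0Sn 1)) ?nnegrE // real_normK ?num_real // pE.
rewrite -subr_ge0 /s /quat_sqnorm.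
case: x y {p p0 pE s} => [a b c d] [a' b' c' d'] /=.
have -> : (a ^+ 2 + b ^+ 2 + c ^+ 2 + d ^+ 2)
    * (a' ^+ 2 + b' ^+ 2 + c' ^+ 2 + d' ^+ 2)
    - (a * a' + b * b' + c * c' + d * d') ^+ 2
  = (a * b' - b * a') ^+ 2 + (a * c' - c * a') ^+ 2 + (a * d' - d * a') ^+ 2
  + (b * c' - c * b') ^+ 2 + (b * d' - d * b') ^+ 2 + (c * d' - d * c') ^+ 2.
  by ring.
by rewrite !addr_ge0 ?sqr_ge0.
Qed.

Fact quat_normZ (a : R) x : quat_norm (a *: x) = `|a| * quat_norm x.
Proof.
rewrite /quat_norm -sqrtr_sqr -sqrtrM ?sqr_ge0 //.
by congr Num.sqrt; rewrite /quat_sqnorm /=; ring.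
Qed.

Fact quat_norm0_eq0 x : quat_norm x = 0 -> x = 0.
Proof.
move=> /eqP; rewrite sqrtr_eq0 => n0.
by apply/eqP; rewrite -quat_sqnorm_eq0 eq_le n0 quat_sqnorm_ge0.
Qed.

HB.instance Definition _ := Lmodule_isNormed.Build R H
  quat_normD quat_normZ quat_norm0_eq0.

Lemma quat_normE x : `|x| =
  Num.sqrt (quat_re x ^+ 2 + quat_i x ^+ 2 + quat_j x ^+ 2 + quat_k x ^+ 2).
Proof. by []. Qed.

End Structures.

Section SliceRegular.
Variable R : realType.
Local Notation H := (quat R).
Implicit Types (f : H -> H) (q I : H) (x y : R).

Definition quat_ball : set H := [set q | `|q| < 1].

Definition imag_sphere : set H := [set I | I ^+ 2 = -1].

Definition slice_pt I x y : H := x%:A + y *: I.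

Definition slice_dx f I x y : H := derive1 (fun t : R => f (slice_pt I t y)) x.

Definition slice_dy f I x y : H := derive1 (fun t : R => f (slice_pt I x t)) y.

(* Functions on the ball are total functions on H: only their values on
   [quat_ball] are constrained. *)
Definition slice_regular f := forall I x y,
  imag_sphere I -> quat_ball (slice_pt I x y) ->
  [/\ derivable (fun t : R => f (slice_pt I t y)) x 1,
      derivable (fun t : R => f (slice_pt I x t)) y 1,
      {for (x, y), continuous (fun p : R * R => slice_dx f I p.1 p.2)},
      {for (x, y), continuous (fun p : R * R => slice_dy f I p.1 p.2)} &
      2^-1 *: (slice_dx f I x y + I * slice_dy f I x y) = 0].

Definition quat_im q : H := Quat 0 (quat_i q) (quat_j q) (quat_k q).

(* Each q is x + y I with x = Re q, y = |Im q| and I = Im q / |Im q|. For real q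
   every imaginary unit is admissible and i is chosen; [slice_derivE] shows that
   the choices do not matter. *)
Definition slice_unit q : H :=
  if quat_im q == 0 then Quat 0 1 0 0 else `|quat_im q|^-1 *: quat_im q.

Definition slice_deriv f q : H :=
  let I := slice_unit q in
  let x := quat_re q in
  let y := `|quat_im q| in
  2^-1 *: (slice_dx f I x y - I * slice_dy f I x y).

Definition slice_S f :=
  [/\ slice_regular f,
      [set q | quat_ball q /\ f q = 0] = [set 0] &
      slice_deriv f 0 = 1].

(* f(q)^-1 q f'(q) and |q f'(q)| / |f(q)|, with their limit 1 at the origin. *)
Definition starlike_quot f q : H :=
  if q == 0 then 1 else (f q)^-1 * q * slice_deriv f q.

Definition starlike_norm_quot f q : R :=
  if q == 0 then 1 else `|q * slice_deriv f q| / `|f q|.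

Definition slice_starlike f :=
  slice_S f /\ forall q, quat_ball q -> 0 < quat_re (starlike_quot f q).

Lemma imag_sphereP I :
  imag_sphere I <-> quat_re I = 0 /\ `|I| = 1.
Proof.
have -> : (`|I| = 1) <-> quat_sqnorm I = 1.
  split=> [h|h]; last by rewrite quat_normE -/(quat_sqnorm I) h sqrtr1.
  by rewrite -(sqr_sqrtr (quat_sqnorm_ge0 I)) -quat_normE h expr1n.
rewrite /imag_sphere /= expr2; case: I => a b c d.
rewrite /quat_sqnorm /=; split=> [[h1 h2 h3 h4]|[-> h]]; last first.
  by apply: quatP => /=; nra.
have a0 : a = 0.
  apply/eqP; apply/negPn/negP => an0.
  have z u : a * u = 0 -> u = 0.
    by move/eqP; rewrite mulf_eq0 (negbTE an0) => /eqP.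
  have b0 : b = 0 by apply: z; lra.
  have c0 : c = 0 by apply: z; lra.
  have d0 : d = 0 by apply: z; lra.
  by move: h1; rewrite b0 c0 d0; nra.
by split=> //; move: h1; rewrite a0; nra.
Qed.

Lemma slice_unit_sphere q : imag_sphere (slice_unit q).
Proof.
apply/imag_sphereP; rewrite /slice_unit; case: eqVneq => [_|n0].
  by rewrite quat_normE /= expr0n /= expr1n add0r !addr0 sqrtr1.
split; first by rewrite /= mulr0.
by rewrite normrZ normfV normr_id mulVf // normr_eq0.
Qed.

Lemma slice_unitE q : `|quat_im q| *: slice_unit q = quat_im q.
Proof.
rewrite /slice_unit; case: eqVneq => [->|n0]; first by rewrite normr0 scale0r.
by rewrite scalerA divff ?scale1r // normr_eq0.
Qed.

Lemma slice_ptE q : slice_pt (slice_unit q) (quat_re q) `|quat_im q| = q.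
Proof.
rewrite /slice_pt slice_unitE.
by apply: quatP => /=; rewrite ?mulr1 ?mulr0 ?addr0 ?add0r.
Qed.

Lemma quat_re_slice_pt I x y : imag_sphere I -> quat_re (slice_pt I x y) = x.
Proof. by case/imag_sphereP => I0 _; rewrite /= I0 mulr0 mulr1 addr0. Qed.

Lemma quat_im_slice_pt I x y :
  imag_sphere I -> quat_im (slice_pt I x y) = y *: I.
Proof.
by case/imag_sphereP => I0 _; apply: quatP; rewrite /= ?I0 ?mulr0 ?add0r.
Qed.

Lemma slice_regular_dx f I x y : slice_regular f ->
  imag_sphere I -> quat_ball (slice_pt I x y) ->
  2^-1 *: (slice_dx f I x y - I * slice_dy f I x y) = slice_dx f I x y.
Proof.
move=> fr IS xyB; have [_ _ _ _ /eqP] := fr _ _ _ IS xyB.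
rewrite scaler_eq0 invr_eq0 pnatr_eq0 /= addrC addr_eq0 => /eqP ->.
rewrite opprK -[X in _ *: (X + _)]scale1r -[X in _ *: (_ + X)]scale1r.
by rewrite -scalerDl scalerA mulVf ?pnatr_eq0 // scale1r.
Qed.

Lemma slice_derivE f I x y : slice_regular f ->
  imag_sphere I -> quat_ball (slice_pt I x y) ->
  slice_deriv f (slice_pt I x y) =
  2^-1 *: (slice_dx f I x y - I * slice_dy f I x y).
Proof.
move=> fr IS xyB; rewrite (slice_regular_dx fr IS xyB) /slice_deriv.
rewrite slice_regular_dx ?slice_ptE //; last exact: slice_unit_sphere.
rewrite /slice_dx quat_re_slice_pt //; congr (derive1 _ _).
by apply/funext => t; rewrite /slice_pt slice_unitE quat_im_slice_pt.
Qed.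

End SliceRegular.

(* Main.v *)
Require Import Defs.
From mathcomp Require Import all_boot all_order all_algebra.
From mathcomp Require Import all_classical all_reals all_analysis.
From mathcomp Require Import complex.
From mathcomp Require Import ring lra.

(* Write f(q) = q E(q) and D = f'. For a regular quotient c = E^{-*} * D one has
   c(E(q)^-1 q E(q)) = E(q)^-1 D(q), and q |-> E(q)^-1 q E(q) maps each sphere
   x + yS onto itself; hence Re c > 0 on the whole ball, c(0) = 1 and c'(0) = a_2.
   Restricted to a slice, Re c is a positive harmonic function, and Jensen's
   inequality for the Poisson kernel (its tangent line as a function of the cosine)
   gives Re c(q) >= m(q) := (1 - |q|^2) / (1 + |a_2| |q| + |q|^2). The same
   argument with E and D exchanged gives Re (D^-1 E) >= m, whence
   m <= |E^-1 D| <= 1/m without any estimate of the imaginary part. Integrating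
   the logarithmic derivative 2 (Re (E^-1 D) - 1) / t of |E(t u)|^2 along rays
   bounds |E|.

   That the power series c converges on the whole ball reduces to inverting the
   real power series of E * E^c, which has no zeros. Its truncations have no zeros
   on a smaller closed disc, so they split into linear factors with roots outside
   it, and Cauchy's estimate bounds the coefficients of their inverses uniformly.
   All circle means are finite averages over roots of unity. *)

Set Implicit Arguments.
Unset Strict Implicit.
Unset Printing Implicit Defensive.

Import Order.TTheory GRing.Theory Num.Theory.
Import numFieldNormedType.Exports.

Local Open Scope classical_set_scope.
Local Open Scope ring_scope.

(** * Quaternions *)

(** The pointwise product E^-1 D is not slice regular, so its real part need not be harmonic on
    slices; this is why it is read as c at a conjugate point. The quotient c has constant term 1 and
    first coefficient d_1 - e_1, where d_n = (n+1) e_n and e_1 = a_2. Exchanging E and D only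
    changes the sign of that coefficient, so the same m serves both ends. The form of m comes from
    the Poisson kernel (1 - s^2) / (1 + s^2 - 2 s x), convex in the cosine x: Re c is a density of
    mass 1 against which the cosine has mean at least -|a_2|/2, and m is the kernel at x = -|a_2|/2.
    E has no zeros because f vanishes only at 0 and E(0) = 1; D has none because Re (E^-1 D) > 0,
    and this sign passes to the inverse. Since only partial sums are averaged, positivity holds up
    to a tail: the estimates carry explicit errors and use a radius s slightly above |q|, and both
    losses disappear in limits, first in the length of the sums and then in s. *)

Section QuatAlgebra.
Variable R : realType.
Local Notation H := (quat R).
Implicit Types (x y z q I : H) (a b t : R).

Lemma quat_norm_sqr x : `|x| ^+ 2 = quat_sqnorm x.
Proof. by rewrite quat_normE sqr_sqrtr // -/(quat_sqnorm x) quat_sqnorm_ge0. Qed.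

Lemma quat_normM x y : `|x * y| = `|x| * `|y|.
Proof.
apply: (@pexpIrn _ 2); rewrite ?nnegrE ?mulr_ge0 //.
rewrite exprMn !quat_norm_sqr /quat_sqnorm.
by case: x y => [a b c d] [a' b' c' d'] /=; ring.
Qed.

Lemma quat_norm1 : `|1 : H| = 1.
Proof. by rewrite quat_normE /= expr0n /= expr1n !addr0 sqrtr1. Qed.

Lemma quat_normX x n : `|x ^+ n| = `|x| ^+ n.
Proof. by elim: n => [|n IH]; rewrite ?expr0 ?quat_norm1 // !exprS quat_normM IH. Qed.

Lemma quat_normV x : `|x^-1| = `|x|^-1.
Proof.
have [->|x0] := eqVneq x 0; first by rewrite invr_out ?unitr0 // normr0 invr0.
have nx : `|x| != 0 by rewrite normr_eq0.
by apply: (mulfI nx); rewrite -quat_normM mulrV // quat_norm1 mulfV.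
Qed.

Lemma quat_unitE x : (x \is a GRing.unit) = (x != 0).
Proof. by []. Qed.

Lemma quat_scalar_comm a x : a%:A * x = x * a%:A.
Proof. by rewrite -scalerAl -scalerAr mul1r mulr1. Qed.

Lemma quat_norm_alg a : `|a%:A : H| = `|a|.
Proof. by rewrite normrZ quat_norm1 mulr1. Qed.

Lemma quat_reD x y : quat_re (x + y) = quat_re x + quat_re y.
Proof. by []. Qed.

Lemma quat_reB x y : quat_re (x - y) = quat_re x - quat_re y.
Proof. by []. Qed.

Lemma quat_reZ a x : quat_re (a *: x) = a * quat_re x.
Proof. by []. Qed.

Lemma quat_re_sum (F : nat -> H) N :
  quat_re (\sum_(n < N) F n) = \sum_(n < N) quat_re (F n).
Proof. by elim: N => [|N IH]; rewrite ?big_ord0 // !big_ord_recr /= IH. Qed.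

Lemma quat_re_norm x : `|quat_re x| <= `|x|.
Proof.
rewrite -(ler_pXn2r (ltn0Sn 1)) ?nnegrE // quat_norm_sqr real_normK ?num_real //.
by rewrite /quat_sqnorm -!addrA lerDl !addr_ge0 ?sqr_ge0.
Qed.

Lemma quat_i_norm x : `|quat_i x| <= `|x|.
Proof.
rewrite -(ler_pXn2r (ltn0Sn 1)) ?nnegrE // quat_norm_sqr real_normK ?num_real //.
rewrite /quat_sqnorm; have := sqr_ge0 (quat_re x); have := sqr_ge0 (quat_j x).
have := sqr_ge0 (quat_k x); lra.
Qed.

Lemma quat_j_norm x : `|quat_j x| <= `|x|.
Proof.
rewrite -(ler_pXn2r (ltn0Sn 1)) ?nnegrE // quat_norm_sqr real_normK ?num_real //.
rewrite /quat_sqnorm; have := sqr_ge0 (quat_re x); have := sqr_ge0 (quat_i x).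
have := sqr_ge0 (quat_k x); lra.
Qed.

Lemma quat_k_norm x : `|quat_k x| <= `|x|.
Proof.
rewrite -(ler_pXn2r (ltn0Sn 1)) ?nnegrE // quat_norm_sqr real_normK ?num_real //.
rewrite /quat_sqnorm; have := sqr_ge0 (quat_re x); have := sqr_ge0 (quat_j x).
have := sqr_ge0 (quat_i x); lra.
Qed.

Lemma quat_norm_le_sum x :
  `|x| <= `|quat_re x| + `|quat_i x| + `|quat_j x| + `|quat_k x|.
Proof.
case: x => a b c d /=.
have -> : Quat a b c d = a *: (Quat 1 0 0 0) + b *: (Quat 0 1 0 0)
    + c *: (Quat 0 0 1 0) + d *: (Quat 0 0 0 1) :> H.
  by apply: quatP => /=; ring.
have n1 e y : quat_sqnorm y = 1 -> `|e *: y| = `|e|.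
  by move=> y1; rewrite normrZ quat_normE -/(quat_sqnorm y) y1 sqrtr1 mulr1.
apply: le_trans (ler_normD _ _) _; apply: lerD; last first.
  by rewrite n1 // /quat_sqnorm /=; ring.
apply: le_trans (ler_normD _ _) _; apply: lerD; last first.
  by rewrite n1 // /quat_sqnorm /=; ring.
apply: le_trans (ler_normD _ _) _; apply: lerD.
  by rewrite n1 // /quat_sqnorm /=; ring.
by rewrite n1 // /quat_sqnorm /=; ring.
Qed.

Lemma quat_conjM x y : quat_conj (x * y) = quat_conj y * quat_conj x.
Proof. by case: x y => [a b c d] [a' b' c' d']; apply: quatP => /=; ring. Qed.

Lemma quat_conj_norm x : `|quat_conj x| = `|x|.
Proof. by rewrite !quat_normE /= !sqrrN. Qed.

Lemma quat_mul_conj x : x * quat_conj x = (`|x| ^+ 2)%:A.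
Proof.
rewrite quat_norm_sqr /quat_sqnorm.
by case: x => [a b c d]; apply: quatP => /=; ring.
Qed.

Lemma quat_conj_mul x : quat_conj x * x = (`|x| ^+ 2)%:A.
Proof.
rewrite quat_norm_sqr /quat_sqnorm.
by case: x => [a b c d]; apply: quatP => /=; ring.
Qed.

Lemma quat_invE x : x != 0 -> x^-1 = (`|x| ^+ 2)^-1 *: quat_conj x.
Proof.
move=> x0; have nx : `|x| ^+ 2 != 0 by rewrite expf_neq0 // normr_eq0.
apply: (@mulrI _ x); first exact: x0.
by rewrite mulrV // -scalerAr quat_mul_conj scalerA mulVf ?scale1r.
Qed.

Lemma quat_re_inv x : x != 0 -> quat_re x^-1 = quat_re x / `|x| ^+ 2.
Proof. by move=> x0; rewrite quat_invE //= mulrC. Qed.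

Lemma conjVX x q n : x != 0 -> (x^-1 * q * x) ^+ n = x^-1 * q ^+ n * x.
Proof.
move=> x0; elim: n => [|n IH]; first by rewrite !expr0 mulr1 mulVr.
by rewrite exprS IH exprS !mulrA mulrK.
Qed.

Lemma conjV_norm x q : x != 0 -> `|x^-1 * q * x| = `|q|.
Proof.
move=> x0; rewrite !quat_normM quat_normV.
by rewrite mulrAC mulVf ?mul1r // normr_eq0.
Qed.

Lemma imag_sphere_mul I : imag_sphere I -> I * I = -1.
Proof. by rewrite /imag_sphere /= expr2. Qed.

Lemma imag_sphereN I : imag_sphere I -> imag_sphere (- I).
Proof. by rewrite /imag_sphere /= sqrrN. Qed.

Lemma imag_sphere_norm I : imag_sphere I -> `|I| = 1.
Proof. by case/imag_sphereP. Qed.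

Lemma slice_ptM I a b a' b' : imag_sphere I ->
  slice_pt I a b * slice_pt I a' b' = slice_pt I (a * a' - b * b') (a * b' + b * a').
Proof.
move=> IS; rewrite /slice_pt mulrDl !mulrDr -!scalerAl !mul1r -!scalerAr !mulr1.
rewrite (imag_sphere_mul IS) !scalerA.
by apply: quatP => /=; ring.
Qed.

Lemma slice_pt_norm I a b : imag_sphere I -> `|slice_pt I a b| ^+ 2 = a ^+ 2 + b ^+ 2.
Proof.
case/imag_sphereP => I0 I1; rewrite quat_norm_sqr.
have: quat_sqnorm I = 1 by rewrite -quat_norm_sqr I1 expr1n.
by rewrite /quat_sqnorm /= I0 => h; nra.
Qed.

Lemma slice_pt_norm_eq I J a b : imag_sphere I -> imag_sphere J ->
  `|slice_pt I a b| = `|slice_pt J a b|.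
Proof.
move=> IS JS; apply: (@pexpIrn _ 2); rewrite ?nnegrE //.
by rewrite !slice_pt_norm.
Qed.

End QuatAlgebra.

(** * Power series with bounded absolute sums *)

Section Limits.
Variables (R : realType) (V : normedModType R).
Implicit Types (u : nat -> V) (l a : V) (v : nat -> R).

Lemma cvgn_norm_le u l v :
  v @ \oo --> (0 : R) -> (forall n, `|u n - l| <= v n) -> u @ \oo --> l.
Proof.
move=> v0 uv; apply/cvgrPdist_lt => eps e0.
have /cvgrPdist_lt /(_ _ e0) := v0; apply: filterS => n.
rewrite distrC subr0 => h; rewrite distrC.
exact: le_lt_trans (le_trans (uv n) (ler_norm _)) h.
Qed.

Lemma cvgn_dist0 u l : u @ \oo --> l -> (fun n => `|u n - l|) @ \oo --> (0 : R).
Proof.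
move=> ul; apply/cvgrPdist_lt => eps e0.
have /cvgrPdist_lt /(_ _ e0) := ul; apply: filterS => n.
by rewrite sub0r normrN normr_id distrC.
Qed.

Lemma lim_norm_le u l a (B : R) (K : nat) : u @ \oo --> l ->
  (forall n, (K <= n)%N -> `|u n - a| <= B) -> `|l - a| <= B.
Proof.
move=> ul uB; apply/ler_addgt0Pr => eps e0.
have /cvgrPdist_lt /(_ _ e0) [M _ hM] := ul.
have h1 := hM (maxn M K) (leq_maxl _ _); have h2 := uB (maxn M K) (leq_maxr _ _).
have -> : l - a = (l - u (maxn M K)) + (u (maxn M K) - a) by rewrite addrA subrK.
by apply: le_trans (ler_normD _ _) _; rewrite addrC lerD // ltW.
Qed.

Lemma cvg_geometric_mul (C x : R) : 0 <= x -> x < 1 ->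
  (fun K => C * x ^+ K) @ \oo --> (0 : R).
Proof.
move=> x0 x1; rewrite -(mulr0 C); apply: cvgMr.
by apply: cvg_expr; rewrite ger0_norm.
Qed.

Lemma ler_of_cvg0 (x y : R) v : v @ \oo --> (0 : R) ->
  (\forall n \near \oo, x <= y + v n) -> x <= y.
Proof.
move=> v0 [K _ h]; apply/ler_addgt0Pr => eps e0.
have /cvgrPdist_lt /(_ _ e0) [M _ hM] := v0.
have := hM (maxn M K) (leq_maxl _ _); rewrite /= distrC subr0 => h1.
apply: le_trans (h (maxn M K) (leq_maxr _ _)) _.
by rewrite lerD2l; apply: le_trans (ler_norm _) (ltW h1).
Qed.

End Limits.

Section QuatSeries.
Variable R : realType.
Local Notation H := (quat R).
Implicit Types (e a b : nat -> H) (q p : H) (t C : R).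

Lemma cvgn_quatM (u : nat -> H) (l x y : H) :
  u @ \oo --> l -> (fun n => x * u n * y) @ \oo --> x * l * y.
Proof.
move=> ul.
apply: (@cvgn_norm_le _ _ _ _ (fun n => `|x| * `|u n - l| * `|y|)).
  rewrite -(mul0r `|y|) -(mulr0 `|x|).
  by apply: cvgMl; apply: cvgMr; exact: cvgn_dist0.
by move=> n; rewrite -mulrBl -mulrBr !quat_normM.
Qed.

Lemma cvgn_quat (u : nat -> H) (l : H) :
  (fun n => quat_re (u n)) @ \oo --> quat_re l ->
  (fun n => quat_i (u n)) @ \oo --> quat_i l ->
  (fun n => quat_j (u n)) @ \oo --> quat_j l ->
  (fun n => quat_k (u n)) @ \oo --> quat_k l -> u @ \oo --> l.
Proof.
move=> h1 h2 h3 h4.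
apply: (@cvgn_norm_le _ _ _ _ (fun n => `|quat_re (u n) - quat_re l|
  + `|quat_i (u n) - quat_i l| + `|quat_j (u n) - quat_j l|
  + `|quat_k (u n) - quat_k l|)); last first.
  by move=> n; apply: quat_norm_le_sum.
have -> : (0 : R) = 0 + 0 + 0 + 0 by rewrite !addr0.
by do 3 (apply: cvgD; last exact: cvgn_dist0); exact: cvgn_dist0.
Qed.

(** Absolute convergence on the whole unit ball, encoded by bounds on partial sums; the bound may
    depend on the radius. *)
Definition pow_summable e := forall t, 0 < t -> t < 1 ->
  exists C, forall N, \sum_(n < N) `|e n| * t ^+ n <= C.

Definition psum e q N : H := \sum_(n < N) q ^+ n * e n.

Definition qsum e q : H := lim (psum e q @ \oo).

Lemma psumS e q N : psum e q N.+1 = psum e q N + q ^+ N * e N.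
Proof. by rewrite /psum big_ord_recr. Qed.

(** Each tail term is at most the term at radius [t] times (|q|/t)^n with n >= K, so a single
    constant gives a geometric rate uniform in [N]. *)
Lemma psum_dist e q t C (K N : nat) : 0 < t -> `|q| <= t -> (K <= N)%N ->
  (forall M, \sum_(n < M) `|e n| * t ^+ n <= C) ->
  `|psum e q N - psum e q K| <= C * (`|q| / t) ^+ K.
Proof.
move=> t0 qt KN eC; apply: (@le_trans _ _ ((\sum_(K <= n < N) `|e n| * t ^+ n)
   * (`|q| / t) ^+ K)); last first.
  apply: ler_wpM2r; first by rewrite exprn_ge0 // divr_ge0 // ltW.
  apply: le_trans (eC N); rewrite -(big_mkord xpredT (fun n => `|e n| * t ^+ n)).
  rewrite [leRHS](big_cat_nat (n := K)) //= lerDr.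
  by apply: sumr_ge0 => n _; rewrite mulr_ge0 // exprn_ge0 // ltW.
rewrite /psum -!(big_mkord xpredT (fun n => q ^+ n * e n)) (big_cat_nat (n := K)) //=.
rewrite addrAC subrr add0r; apply: le_trans (ler_norm_sum _ _ _) _.
rewrite big_distrl /= big_nat_cond [leRHS]big_nat_cond.
apply: ler_sum => n; rewrite andbT => /andP[Kn nN].
rewrite quat_normM quat_normX.
have -> : `|q| ^+ n = (`|q| / t) ^+ n * t ^+ n.
  by rewrite expr_div_n mulfVK // expf_neq0 // gt_eqF.
rewrite mulrC -mulrA [_ * t ^+ n]mulrC mulrA mulrA ler_wpM2l ?mulr_ge0 ?exprn_ge0 ?(ltW t0) //.
have x0 : 0 <= `|q| / t by rewrite divr_ge0 // ltW.
by apply: ler_wiXn2l => //; rewrite ler_pdivrMr // mul1r.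
Qed.

Lemma mid_radius (x : R) : 0 <= x -> x < 1 ->
  [/\ 0 < (x + 1) / 2, (x + 1) / 2 < 1 & x < (x + 1) / 2].
Proof. by move=> x0 x1; split; lra. Qed.

Lemma cvg_psum_comp (u : nat -> R) (v : nat -> R) C :
  (forall N, \sum_(n < N) v n <= C) -> (forall n, `|u n| <= v n) ->
  cvgn (fun N => \sum_(n < N) u n).
Proof.
move=> vC uv.
have -> : (fun N => \sum_(n < N) u n) = series u.
  by rewrite seriesEord.
apply: normed_cvg.
rewrite (_ : [normed series u] = fun N => \sum_(n < N) `|u n|); last first.
  by apply/funext => N; rewrite -(big_mkord xpredT (fun n => `|u n|)).
apply: nondecreasing_is_cvgn.
  by apply/nondecreasing_seqP => n; rewrite big_ord_recr /= lerDl.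
by exists C => _ [N _ <-]; apply: le_trans (vC N); apply: ler_sum.
Qed.

Lemma cvg_psum e q : pow_summable e -> `|q| < 1 -> psum e q @ \oo --> qsum e q.
Proof.
move=> es q1; apply/cvg_ex => /=.
have [t0 t1 qt] := mid_radius (normr_ge0 q) q1.
have [C eC] := es _ t0 t1.
have nC n : `|q ^+ n * e n| <= `|e n| * ((`|q| + 1) / 2) ^+ n.
  rewrite quat_normM quat_normX mulrC ler_wpM2l //.
  by apply: lerXn2r; rewrite ?nnegrE // ltW.
have /cvg_ex [l1 h1] : cvgn (fun N => \sum_(n < N) quat_re (q ^+ n * e n)).
  by apply: (cvg_psum_comp (u := fun n => quat_re (q ^+ n * e n)) eC) => n;
    apply: le_trans (nC n); apply: quat_re_norm.
have /cvg_ex [l2 h2] : cvgn (fun N => \sum_(n < N) quat_i (q ^+ n * e n)).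
  by apply: (cvg_psum_comp (u := fun n => quat_i (q ^+ n * e n)) eC) => n;
    apply: le_trans (nC n); apply: quat_i_norm.
have /cvg_ex [l3 h3] : cvgn (fun N => \sum_(n < N) quat_j (q ^+ n * e n)).
  by apply: (cvg_psum_comp (u := fun n => quat_j (q ^+ n * e n)) eC) => n;
    apply: le_trans (nC n); apply: quat_j_norm.
have /cvg_ex [l4 h4] : cvgn (fun N => \sum_(n < N) quat_k (q ^+ n * e n)).
  by apply: (cvg_psum_comp (u := fun n => quat_k (q ^+ n * e n)) eC) => n;
    apply: le_trans (nC n); apply: quat_k_norm.
exists (Quat l1 l2 l3 l4); apply: cvgn_quat => /=.
- apply: cvg_trans h1; apply: near_eq_cvg; apply: nearW => N.
  by elim: N => [|N IH]; rewrite ?psumS ?big_ord_recr /psum ?big_ord0 //= IH.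
- apply: cvg_trans h2; apply: near_eq_cvg; apply: nearW => N.
  by elim: N => [|N IH]; rewrite ?psumS ?big_ord_recr /psum ?big_ord0 //= IH.
- apply: cvg_trans h3; apply: near_eq_cvg; apply: nearW => N.
  by elim: N => [|N IH]; rewrite ?psumS ?big_ord_recr /psum ?big_ord0 //= IH.
- apply: cvg_trans h4; apply: near_eq_cvg; apply: nearW => N.
  by elim: N => [|N IH]; rewrite ?psumS ?big_ord_recr /psum ?big_ord0 //= IH.
Qed.

Lemma qsum_unique e q l : psum e q @ \oo --> l -> qsum e q = l.
Proof. by move=> h; apply: cvg_lim. Qed.

Lemma qsum_dist e q t C (K : nat) : pow_summable e -> 0 < t -> t < 1 -> `|q| <= t ->
  (forall M, \sum_(n < M) `|e n| * t ^+ n <= C) ->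
  `|qsum e q - psum e q K| <= C * (`|q| / t) ^+ K.
Proof.
move=> es t0 t1 qt eC; apply: (lim_norm_le (K := K)).
  by apply: cvg_psum => //; apply: le_lt_trans t1.
by move=> n Kn; apply: psum_dist.
Qed.

Lemma qsum0 e : qsum e 0 = e 0%N.
Proof.
apply: qsum_unique; apply: cvg_near_cst; exists 1%N => // -[|N] //= _.
rewrite /psum big_ord_recl expr0 mul1r big1 ?addr0 // => i _.
by rewrite expr0n /= mul0r.
Qed.

Lemma pow_summable_le e a : pow_summable a -> (forall n, `|e n| <= `|a n|) ->
  pow_summable e.
Proof.
move=> as_ ea t t0 t1; have [C hC] := as_ t t0 t1; exists C => N.
apply: le_trans (hC N); apply: ler_sum => i _.
by rewrite ler_wpM2r // exprn_ge0 // ltW.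
Qed.

Lemma pow_summableZn e : pow_summable e -> pow_summable (fun n => n%:R *: e n).
Proof.
move=> es t t0 t1; have [s0 s1 ts] := mid_radius (ltW t0) t1.
set s := (t + 1) / 2 in s0 s1 ts; have [C hC] := es s s0 s1.
have d0 : 0 < s / t - 1 by rewrite subr_gt0 ltr_pdivlMr // mul1r.
(* Bernoulli's inequality for (s/t)^n: passing to the larger radius [s] absorbs the factor n. *)
have bern n : n%:R * t ^+ n <= s ^+ n / (s / t - 1).
  rewrite ler_pdivlMr // mulrAC -ler_pdivlMr ?exprn_gt0 // -expr_div_n.
  elim: n => [|n IH]; first by rewrite mul0r expr0.
  rewrite exprS; have x1 : 1 <= s / t by rewrite ler_pdivlMr // mul1r ltW.
  have := exprn_ege1 n x1.
  move: IH x1; rewrite -natr1; set x := s / t; set y := x ^+ n; set m : R := n%:R.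
  by move=> *; nra.
exists (C / (s / t - 1)) => N.
apply: (@le_trans _ _ ((\sum_(n < N) `|e n| * s ^+ n) / (s / t - 1))); last first.
  by rewrite ler_pM2r ?invr_gt0.
rewrite big_distrl /=; apply: ler_sum => n _.
by rewrite normrZ normr_nat mulrAC mulrC -[leRHS]mulrA ler_wpM2l.
Qed.

Lemma pow_summableS e : pow_summable e -> pow_summable (fun n => e n.+1).
Proof.
move=> es t t0 t1; have [C hC] := es t t0 t1; exists (C / t) => N.
rewrite ler_pdivlMr //; apply: le_trans (hC N.+1).
rewrite big_ord_recl /= expr0 mulr1 big_distrl /= ler_wpDl //.
by apply: ler_sum => i _; rewrite /bump /= add1n exprSr mulrA.
Qed.

(** Terms bounded at a larger radius [s] are summable at [t] by comparison with the geometric series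
    of ratio t/s. The coefficients of f and those of a formal inverse are both controlled only
    termwise at first. *)
Lemma pow_summable_bounded e :
  (forall t, 0 < t -> t < 1 -> exists C, forall n, `|e n| * t ^+ n <= C) ->
  pow_summable e.
Proof.
move=> eb t t0 t1; have [s0 s1 ts] := mid_radius (ltW t0) t1.
set s := (t + 1) / 2 in s0 s1 ts; have [C hC] := eb s s0 s1.
have x1 : t / s < 1 by rewrite ltr_pdivrMr // mul1r.
have x0 : 0 <= t / s by rewrite divr_ge0 // ltW.
have C0 : 0 <= C by apply: le_trans (hC 0%N); rewrite mulr_ge0 // exprn_ge0 // ltW.
exists (C / (1 - t / s)) => N; rewrite ler_pdivlMr ?subr_gt0 //.
apply: (@le_trans _ _ (\sum_(n < N) C * (t / s) ^+ n * (1 - t / s))).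
  rewrite -big_distrl /= ler_wpM2r ?subr_ge0 ?(ltW x1) //; apply: ler_sum => n _.
  rewrite expr_div_n mulrA ler_pdivlMr ?exprn_gt0 // mulrAC ler_wpM2r //.
  by rewrite exprn_ge0 // ltW.
rewrite -big_distrl -big_distrr /= -mulrA.
have -> : (\sum_(i < N) (t / s) ^+ i) * (1 - t / s) = 1 - (t / s) ^+ N.
  by rewrite -[1 in RHS](expr1n _ N) subrXX mulrC; congr (_ * _); apply: eq_bigr => i _; rewrite expr1n mul1r.
by rewrite ler_piMr // lerBlDr lerDl exprn_ge0.
Qed.

End QuatSeries.

(** * Cauchy products *)

Section Convolution.
Variable K : nzRingType.
Implicit Types (a b c : nat -> K).

(** With powers on the left and coefficients on the right, this is the regular product of slice
    regular functions. *)
Definition cauchy_prod a b n : K := \sum_(k < n.+1) a k * b (n - k)%N.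

Lemma cauchy_prod_coef a b (p q : {poly K}) n :
  (forall i, (i <= n)%N -> p`_i = a i) -> (forall i, (i <= n)%N -> q`_i = b i) ->
  cauchy_prod a b n = (p * q)`_n.
Proof.
move=> pa qb; rewrite coefM; apply: eq_bigr => i _.
by rewrite pa ?qb ?leq_subr // -ltnS.
Qed.

Lemma cauchy_prod_polyE a b n N : (n < N)%N ->
  cauchy_prod a b n = ((\poly_(i < N) a i) * (\poly_(i < N) b i))`_n.
Proof.
by move=> nN; apply: cauchy_prod_coef => i im; rewrite coef_poly (leq_ltn_trans im nN).
Qed.

(** Coefficient [n] sees only the terms up to [n], so associativity is inherited from polynomials
    over [K]. *)
Lemma cauchy_prodA a b c : cauchy_prod a (cauchy_prod b c) = cauchy_prod (cauchy_prod a b) c.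
Proof.
apply/funext => n; pose P (s : nat -> K) := \poly_(i < n.+1) s i.
have PE s i : (i <= n)%N -> (P s)`_i = s i by move=> im; rewrite coef_poly ltnS im.
have cauchy_prod_coefE u v i : (i <= n)%N -> (P u * P v)`_i = cauchy_prod u v i.
  by move=> im; rewrite (@cauchy_prod_polyE _ _ _ n.+1).
have -> : cauchy_prod a (cauchy_prod b c) n = (P a * (P b * P c))`_n.
  by apply: cauchy_prod_coef => i im; [exact: PE | exact: cauchy_prod_coefE].
rewrite mulrA; apply/esym/cauchy_prod_coef => i im; [exact: cauchy_prod_coefE | exact: PE].
Qed.

Definition cauchy_one n : K := (n == 0%N)%:R.

Lemma cauchy_prod1 a : cauchy_prod cauchy_one a = a.
Proof.
apply/funext => n; rewrite /cauchy_prod big_ord_recl /= subn0 /cauchy_one mul1r big1 ?addr0 //.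
by move=> i _; rewrite mul0r.
Qed.

Lemma cauchy_prod0n a b : cauchy_prod a b 0 = a 0%N * b 0%N.
Proof. by rewrite /cauchy_prod big_ord_recl big_ord0 addr0. Qed.

Lemma cauchy_prod1n a b : cauchy_prod a b 1 = a 0%N * b 1%N + a 1%N * b 0%N.
Proof. by rewrite /cauchy_prod !big_ord_recl big_ord0 addr0. Qed.

End Convolution.

Lemma sum_triangle (V : nmodType) (F : nat -> nat -> V) K :
  \sum_(n < K) \sum_(k < n.+1) F k (n - k)%N = \sum_(k < K) \sum_(m < K - k) F k m.
Proof.
elim: K => [|K IH]; first by rewrite !big_ord0.
rewrite big_ord_recr /= IH; transitivity
  (\sum_(k < K.+1) (\sum_(m < K - k) F k m + F k (K - k)%N)).
  rewrite big_split /=; congr (_ + _).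
  by rewrite big_ord_recr /= subnn big_ord0 addr0.
by apply: eq_bigr => k _; rewrite subSn ?big_ord_recr // -ltnS.
Qed.

Section CauchyProduct.
Variable R : realType.
Local Notation H := (quat R).
Implicit Types (e a b : nat -> H) (q p v : H) (t C : R).

Lemma pow_summable_cauchy_prod a b : pow_summable a -> pow_summable b ->
  pow_summable (cauchy_prod a b).
Proof.
move=> as_ bs t t0 t1; have [Ca hA] := as_ t t0 t1; have [Cb hB] := bs t t0 t1.
exists (Ca * Cb) => N.
apply: (@le_trans _ _ ((\sum_(k < N) `|a k| * t ^+ k) * \sum_(m < N) `|b m| * t ^+ m)).
  pose F k m := (`|a k| * t ^+ k) * (`|b m| * t ^+ m).
  have F0 k m : 0 <= F k m by rewrite !mulr_ge0 ?exprn_ge0 // ltW.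
  apply: (@le_trans _ _ (\sum_(n < N) \sum_(k < n.+1) F k (n - k)%N)).
    apply: ler_sum => n _; apply: (@le_trans _ _
      ((\sum_(k < n.+1) `|a k * b (n - k)%N|) * t ^+ n)).
      by rewrite ler_wpM2r ?ler_norm_sum // exprn_ge0 // ltW.
    rewrite big_distrl /=; apply: ler_sum => k _.
    by rewrite quat_normM /F mulrACA -exprD subnKC // -ltnS.
  rewrite sum_triangle big_distrl /=; apply: ler_sum => k _; rewrite big_distrr /=.
  rewrite -(big_mkord xpredT (F k)) -(big_mkord xpredT (F k)).
  rewrite [leRHS](big_cat_nat (n := (N - k)%N)) ?leq_subr //= lerDl.
  by apply: sumr_ge0.
have S0 (e : nat -> H) : 0 <= \sum_(k < N) `|e k| * t ^+ k.
  by apply: sumr_ge0 => k _; rewrite mulr_ge0 ?exprn_ge0 // ltW.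
by apply: ler_pM.
Qed.

(** Since [q] does not commute with the coefficients, the partial sum of [a] stays between the power
    of [q] and the coefficient of [b]. The pairs left out have k + m >= K, so each is at most its
    value at radius [t] times (|q|/t)^K. *)
Lemma cauchy_product_dist a b q t Ca Cb K : 0 < t -> `|q| <= t ->
  (forall M, \sum_(n < M) `|a n| * t ^+ n <= Ca) ->
  (forall M, \sum_(n < M) `|b n| * t ^+ n <= Cb) ->
  `|psum (cauchy_prod a b) q K - \sum_(m < K) q ^+ m * psum a q K * b m|
    <= Ca * Cb * (`|q| / t) ^+ K.
Proof.
move=> t0 qt hA hB; pose F k m := q ^+ (m + k) * (a k * b m).
pose x := `|q| / t; have x0 : 0 <= x by rewrite divr_ge0 // ltW.
have x1 : x <= 1 by rewrite ler_pdivrMr // mul1r.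
have -> : psum (cauchy_prod a b) q K = \sum_(k < K) \sum_(m < K - k) F k m.
  rewrite -sum_triangle; apply: eq_bigr => n _; rewrite big_distrr /=.
  by apply: eq_bigr => k _; rewrite /F subnK // -ltnS.
have -> : \sum_(m < K) q ^+ m * psum a q K * b m = \sum_(k < K) \sum_(m < K) F k m.
  rewrite exchange_big /=; apply: eq_bigr => m _.
  rewrite /psum mulr_sumr mulr_suml; apply: eq_bigr => k _.
  by rewrite /F exprD !mulrA.
rewrite distrC -sumrB.
apply: (@le_trans _ _ (\sum_(k < K) \sum_(m < K)
    (`|a k| * t ^+ k) * (`|b m| * t ^+ m) * x ^+ K)); last first.
  under eq_bigr do rewrite -big_distrl -big_distrr /=.
  rewrite -!big_distrl /= ler_wpM2r ?exprn_ge0 //.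
  have S0 (e : nat -> H) : 0 <= \sum_(k < K) `|e k| * t ^+ k.
    by apply: sumr_ge0 => k _; rewrite mulr_ge0 ?exprn_ge0 // ltW.
  exact: ler_pM (S0 a) (S0 b) (hA K) (hB K).
apply: le_trans (ler_norm_sum _ _ _) _; apply: ler_sum => k _.
rewrite -!(big_mkord xpredT (F k)) (big_cat_nat (n := (K - k)%N)) ?leq_subr //=.
rewrite addrAC subrr add0r.
pose G m := `|a k| * t ^+ k * (`|b m| * t ^+ m) * x ^+ K.
rewrite -(big_mkord xpredT G) [leRHS](big_cat_nat (n := (K - k)%N)) ?leq_subr //=.
have G0 m : 0 <= G m by rewrite !mulr_ge0 ?exprn_ge0 // ltW.
rewrite ler_wpDl ?sumr_ge0 //; apply: le_trans (ler_norm_sum _ _ _) _.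
apply: ler_sum_nat => m /andP[Km _]; rewrite /F /G !quat_normM quat_normX mulrACA -exprD.
have -> : `|q| ^+ (m + k) = x ^+ (m + k) * t ^+ (m + k).
  by rewrite /x expr_div_n mulfVK // expf_neq0 // gt_eqF.
rewrite [(k + m)%N]addnC.
rewrite [leLHS](_ : _ = `|a k| * `|b m| * t ^+ (m + k) * x ^+ (m + k)).
  rewrite ler_wpM2l ?mulr_ge0 ?exprn_ge0 ?(ltW t0) //.
  by apply: ler_wiXn2l => //; rewrite addnC -leq_subLR.
by rewrite mulrC -[RHS]mulrA [t ^+ _ * _]mulrC.
Qed.

Lemma cvg_qsum_cauchy_prod a b q : pow_summable a -> pow_summable b -> `|q| < 1 ->
  (fun K => \sum_(m < K) q ^+ m * qsum a q * b m) @ \oo --> qsum (cauchy_prod a b) q.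
Proof.
move=> as_ bs q1; have cs := pow_summable_cauchy_prod as_ bs.
have [t0 t1 qt] := mid_radius (normr_ge0 q) q1.
set t := (`|q| + 1) / 2 in t0 t1 qt.
have [Ca hA] := as_ t t0 t1; have [Cb hB] := bs t t0 t1.
have [Cc hC] := cs t t0 t1.
pose x := `|q| / t; have x0 : 0 <= x by rewrite divr_ge0 // ltW.
have x1 : x < 1 by rewrite ltr_pdivrMr // mul1r.
(* Three errors: the full sum of [a] against its partial sum inside the product, the truncated
   Cauchy product, and the tail of the product series. *)
apply: (@cvgn_norm_le _ _ _ _ (fun K => (Ca * Cb + (Ca * Cb + Cc)) * x ^+ K)).
  exact: cvg_geometric_mul.
move=> K; rewrite !mulrDl.
have -> : \sum_(m < K) q ^+ m * qsum a q * b m - qsum (cauchy_prod a b) q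
  = \sum_(m < K) q ^+ m * (qsum a q - psum a q K) * b m
  + ((\sum_(m < K) q ^+ m * psum a q K * b m - psum (cauchy_prod a b) q K)
  + (psum (cauchy_prod a b) q K - qsum (cauchy_prod a b) q)).
  rewrite subrKA addrA -big_split /=; congr (_ - _).
  by apply: eq_bigr => m _; rewrite -mulrDl -mulrDr subrK.
apply: le_trans (ler_normD _ _) _; apply: lerD; last first.
  apply: le_trans (ler_normD _ _) _; apply: lerD; rewrite distrC.
    by apply: cauchy_product_dist => //; apply: ltW.
  by apply: qsum_dist => //; apply: ltW.
apply: le_trans (ler_norm_sum _ _ _) _.
have h := qsum_dist K as_ t0 t1 (ltW qt) hA.
apply: (@le_trans _ _ (\sum_(m < K) (Ca * x ^+ K) * (`|b m| * t ^+ m))).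
  apply: ler_sum => m _; rewrite !quat_normM quat_normX.
  rewrite mulrAC mulrC; apply: ler_pM; rewrite ?mulr_ge0 ?exprn_ge0 //.
  rewrite mulrC ler_wpM2l //; apply: lerXn2r; rewrite ?nnegrE // ltW //.
rewrite -big_distrr /= mulrAC ler_wpM2r ?exprn_ge0 // ler_wpM2l //.
  by apply: le_trans (hA 0%N); rewrite big_ord0.
exact: hB.
Qed.

(** From q^m v = v (v^-1 q v)^m: a regular product becomes a pointwise one at the cost of moving the
    point of the second factor. *)
Lemma qsum_cauchy_prod_conj a b q (v := qsum a q) : pow_summable a -> pow_summable b ->
  `|q| < 1 -> v != 0 -> qsum b (v^-1 * q * v) = v^-1 * qsum (cauchy_prod a b) q.
Proof.
move=> as_ bs q1 v0; apply: qsum_unique.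
have h := cvgn_quatM (x := v^-1) (y := 1) (cvg_qsum_cauchy_prod as_ bs q1).
rewrite [_ * 1]mulr1 in h.
apply: cvg_trans h; apply: near_eq_cvg; apply: nearW => N; rewrite mulr1 mulr_sumr.
by apply: eq_bigr => n _; rewrite conjVX // !mulrA.
Qed.

End CauchyProduct.

(** * Values on a sphere and the symmetrization *)

Section Stem.
Variable R : realType.
Local Notation H := (quat R).
Implicit Types (e : nat -> H) (p q k I J al be : H) (x y : R).

(** Real and imaginary parts of (x + iy)^n. They do not depend on the imaginary unit, which ties
    together the values on a sphere. *)
Fixpoint slice_pow x y n : R * R :=
  if n is m.+1 then let s := slice_pow x y m in
    (x * s.1 - y * s.2, x * s.2 + y * s.1) else (1, 0).

Lemma slice_ptX I x y n : imag_sphere I ->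
  slice_pt I x y ^+ n = slice_pt I (slice_pow x y n).1 (slice_pow x y n).2.
Proof.
move=> IS; elim: n => [|n IH]; first by rewrite expr0 /slice_pt /= scale0r addr0 scale1r.
by rewrite exprS IH slice_ptM.
Qed.

(* The values on the sphere x + yS are al + J be, J being the imaginary unit. *)
Definition stem_of e x y al be :=
  (fun N => \sum_(n < N) (slice_pow x y n).1 *: e n) @ \oo --> al /\
  (fun N => \sum_(n < N) (slice_pow x y n).2 *: e n) @ \oo --> be.

Lemma stem_exists e I x y : pow_summable e -> imag_sphere I ->
  `|slice_pt I x y| < 1 -> exists al be, stem_of e x y al be.
Proof.
move=> es IS p1; have NS := imag_sphereN IS.
have p1' : `|slice_pt (- I) x y| < 1 by rewrite (slice_pt_norm_eq _ _ NS IS).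
have h1 := cvg_psum es p1; have h2 := cvg_psum es p1'.
set l1 := qsum _ _ in h1; set l2 := qsum _ _ in h2.
(* Solves al + I be = l1 and al - I be = l2, the values at x + yI and x - yI. *)
exists (2^-1 *: (l1 + l2)), (- (2^-1 *: (I * (l1 - l2)))); split.
  have -> : (fun N => \sum_(n < N) (slice_pow x y n).1 *: e n) =
     fun N => (2^-1)%:A * (psum e (slice_pt I x y) N + psum e (slice_pt (- I) x y) N) * 1.
    apply/funext => N /=; rewrite mulr1 /psum -big_split mulr_sumr; apply: eq_bigr => n _ /=.
    rewrite !slice_ptX // -mulrDl /slice_pt scalerN addrACA subrr addr0 -scalerDl.
    rewrite -!scalerAl !mul1r scalerA; congr (_ *: _); lra.
  have -> : 2^-1 *: (l1 + l2) = (2^-1)%:A * (l1 + l2) * 1.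
    by rewrite mulr1 -scalerAl mul1r.
  exact: (cvgn_quatM (cvgD h1 h2)).
have -> : (fun N => \sum_(n < N) (slice_pow x y n).2 *: e n) =
   fun N => (- (2^-1 *: I)) * (psum e (slice_pt I x y) N - psum e (slice_pt (- I) x y) N) * 1.
  apply/funext => N /=; rewrite mulr1 /psum -sumrB mulr_sumr; apply: eq_bigr => n _.
  rewrite !slice_ptX // -mulrBl /slice_pt scalerN opprD opprK addrACA subrr add0r.
  rewrite -scalerDl mulrA mulNr -scalerAl -scalerAr scalerA (imag_sphere_mul IS).
  rewrite scalerN opprK -scalerAl mul1r; congr (_ *: _); lra.
have -> : - (2^-1 *: (I * (l1 - l2))) = (- (2^-1 *: I)) * (l1 - l2) * 1.
  by rewrite mulr1 mulNr scalerAl.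
exact: (cvgn_quatM (cvgB h1 h2)).
Qed.

(** The inserted [k] has three uses: k = 1 gives plain values, k the value of a left factor gives a
    regular product, and the k built in [qsum_conj_surj] inverts the conjugation map. *)
Lemma stem_twist e x y al be J k : stem_of e x y al be -> imag_sphere J ->
  (fun N => \sum_(n < N) slice_pt J x y ^+ n * k * e n) @ \oo --> k * al + J * k * be.
Proof.
move=> [ha hb] JS.
have -> : (fun N => \sum_(n < N) slice_pt J x y ^+ n * k * e n) =
  (fun N => k * (\sum_(n < N) (slice_pow x y n).1 *: e n) * 1
    + (J * k) * (\sum_(n < N) (slice_pow x y n).2 *: e n) * 1).
  apply/funext => N; rewrite !mulr1 !mulr_sumr -big_split; apply: eq_bigr => n _ /=.
  by rewrite slice_ptX // /slice_pt !mulrDl -!scalerAl mul1r -!scalerAr.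
rewrite -[k * al]mulr1 -[J * k * be]mulr1.
by apply: cvgD; apply: cvgn_quatM.
Qed.

Lemma stem_qsum e x y al be J : stem_of e x y al be -> imag_sphere J ->
  qsum e (slice_pt J x y) = al + J * be.
Proof.
move=> st JS; apply: qsum_unique; have := stem_twist (k := 1) st JS.
rewrite mul1r mulr1; apply: cvg_trans; apply: near_eq_cvg; apply: nearW => N.
by apply: eq_bigr => n _; rewrite mulr1.
Qed.

Lemma stem_conj e x y al be : stem_of e x y al be ->
  stem_of (fun n => quat_conj (e n)) x y (quat_conj al) (quat_conj be).
Proof.
have cc (c : nat -> R) l : (fun N => \sum_(n < N) c n *: e n) @ \oo --> l ->
    (fun N => \sum_(n < N) c n *: quat_conj (e n)) @ \oo --> quat_conj l.
  move=> h; apply: (@cvgn_norm_le _ _ _ _ _ (cvgn_dist0 h)) => N.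
  have -> : \sum_(n < N) c n *: quat_conj (e n) = quat_conj (\sum_(n < N) c n *: e n).
    elim: N => [|N IH]; first by rewrite !big_ord0; apply: quatP => /=; rewrite ?oppr0.
    by rewrite !big_ord_recr /= IH; apply: quatP => /=; ring.
  rewrite -[leRHS]quat_conj_norm le_eqVlt; apply/orP; left; apply/eqP; congr `|_|.
  by apply: quatP => /=; ring.
by case=> ha hb; split; [apply: (cc (fun n => (slice_pow x y n).1))
  | apply: (cc (fun n => (slice_pow x y n).2))].
Qed.

(** The symmetrization of the series. Its coefficients turn out to be real, so that inverting it is
    a commutative problem. *)
Definition norm_seq e := cauchy_prod e (fun n => quat_conj (e n)).

Lemma pow_summable_quat_conj e : pow_summable e -> pow_summable (fun n => quat_conj (e n)).
Proof. by move=> es; apply: pow_summable_le es _ => n; rewrite quat_conj_norm. Qed.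

Lemma pow_summable_norm_seq e : pow_summable e -> pow_summable (norm_seq e).
Proof. by move=> es; apply: pow_summable_cauchy_prod => //; apply: pow_summable_quat_conj. Qed.

(** Conjugation reverses each product, which only reverses the order of summation; so every
    coefficient is its own conjugate. *)
Lemma norm_seq_real e n : norm_seq e n = (quat_re (norm_seq e n))%:A.
Proof.
have : quat_conj (norm_seq e n) = norm_seq e n.
  rewrite /norm_seq /cauchy_prod.
  have cs (F : nat -> H) N : quat_conj (\sum_(k < N) F k) = \sum_(k < N) quat_conj (F k).
    elim: N => [|N IH]; first by rewrite !big_ord0; apply: quatP => /=; rewrite ?oppr0.
    by rewrite !big_ord_recr /= -IH; apply: quatP => /=; ring.
  rewrite (cs (fun i => e i * quat_conj (e (n - i)%N))) (reindex_inj rev_ord_inj) /=.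
  apply: eq_bigr => i _; have im : (i <= n)%N by rewrite -ltnS.
  rewrite subSS quat_conjM (subKn im); congr (_ * _).
  by case: (e i) => *; apply: quatP => /=; rewrite ?opprK.
case: (norm_seq e n) => a b c d [hb hc hd].
by apply: quatP => /=; rewrite ?mulr1 ?mulr0 //; lra.
Qed.

Lemma slice_comm I (a b : R) : I * slice_pt I a b = slice_pt I a b * I.
Proof. by rewrite /slice_pt mulrDr mulrDl -!scalerAr -!scalerAl mulr1 mul1r. Qed.

Lemma stem_norm_value I al be (v := al + I * be) : imag_sphere I ->
  v * quat_conj al + I * v * quat_conj be =
  slice_pt I (`|al| ^+ 2 - `|be| ^+ 2) (2 * quat_re (al * quat_conj be)).
Proof.
move=> IS; transitivity (al * quat_conj al - be * quat_conj be
    + I * (al * quat_conj be + be * quat_conj al)).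
  rewrite /v [I * (al + _)]mulrDr [I * (I * _)]mulrA (imag_sphere_mul IS) mulN1r !mulrDl.
  by rewrite mulNr mulrDr -!mulrA; apply: quatP => /=; ring.
have -> : al * quat_conj be + be * quat_conj al = (2 * quat_re (al * quat_conj be))%:A.
  by case: al be {v} => [? ? ? ?] [? ? ? ?]; apply: quatP => /=; ring.
by rewrite !quat_mul_conj /slice_pt scalerBl -scalerAr mulr1.
Qed.

(** If the value vanished with be nonzero, then |al| = |be| and al be^-1 would have real part 0, so
    J = - al be^-1 would be an imaginary unit with al + J be = 0. Thus the symmetrization vanishes
    only on spheres where the series itself has a zero. *)
Lemma stem_norm_value_neq0 I al be : imag_sphere I ->
  (forall J, imag_sphere J -> al + J * be != 0) ->
  slice_pt I (`|al| ^+ 2 - `|be| ^+ 2) (2 * quat_re (al * quat_conj be)) != 0.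
Proof.
move=> IS nz; apply/eqP => n0.
have := slice_pt_norm (`|al| ^+ 2 - `|be| ^+ 2) (2 * quat_re (al * quat_conj be)) IS.
rewrite n0 normr0 expr0n /= => h.
have h1 : `|al| ^+ 2 = `|be| ^+ 2.
  by apply/eqP; rewrite -subr_eq0 -sqrf_eq0; apply/eqP; move: h;
  have := sqr_ge0 (2 * quat_re (al * quat_conj be));
  have := sqr_ge0 (`|al| ^+ 2 - `|be| ^+ 2); lra.
have h2 : quat_re (al * quat_conj be) = 0.
  by move: h; rewrite h1 subrr expr0n /= add0r => /esym/eqP; rewrite sqrf_eq0 mulf_eq0 pnatr_eq0 /= => /eqP.
have [be0|be0] := eqVneq be 0.
  have al0 : al = 0.
    by apply/eqP; rewrite -normr_eq0 -sqrf_eq0 h1 be0 normr0 expr0n.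
  by have /eqP := nz _ IS; rewrite al0 be0 mulr0 addr0; apply.
have JS : imag_sphere (- (al * be^-1)).
  apply/imag_sphereP; split.
    by rewrite quat_invE // -scalerAr /= -/(quat_re _) h2 mulr0 oppr0.
  rewrite normrN quat_normM quat_normV.
  have -> : `|al| = `|be| by apply: (@pexpIrn _ 2); rewrite ?nnegrE.
  by rewrite mulfV // normr_eq0.
by have /eqP := nz _ JS; rewrite mulNr mulrVK // subrr; apply.
Qed.

Lemma qsum_norm_seq e x y al be I : pow_summable e -> imag_sphere I ->
  `|slice_pt I x y| < 1 -> stem_of e x y al be ->
  qsum (norm_seq e) (slice_pt I x y) =
  slice_pt I (`|al| ^+ 2 - `|be| ^+ 2) (2 * quat_re (al * quat_conj be)).
Proof.
move=> es IS p1 st; rewrite -stem_norm_value //.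
have h1 := cvg_qsum_cauchy_prod es (pow_summable_quat_conj es) p1.
rewrite (stem_qsum st IS) in h1.
have h2 := stem_twist (k := al + I * be) (stem_conj st) IS.
by rewrite /norm_seq; apply: cvg_unique h1 h2.
Qed.

Lemma norm_seq_neq0 e p : pow_summable e ->
  (forall q, `|q| < 1 -> qsum e q != 0) -> `|p| < 1 -> qsum (norm_seq e) p != 0.
Proof.
move=> es nz; rewrite -(slice_ptE p) => p1.
have IS := slice_unit_sphere p.
have [al [be st]] := stem_exists es IS p1.
rewrite (qsum_norm_seq es IS p1 st); apply: stem_norm_value_neq0 => // J JS.
by rewrite -(stem_qsum st JS); apply: nz; rewrite (slice_pt_norm_eq _ _ JS IS).
Qed.

Lemma qsum_conj_surj e p : pow_summable e ->
  (forall q, `|q| < 1 -> qsum e q != 0) -> `|p| < 1 ->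
  exists2 q, `|q| = `|p| & (qsum e q)^-1 * q * qsum e q = p.
Proof.
move=> es nz; rewrite -(slice_ptE p) => p1.
have IS := slice_unit_sphere p; set I := slice_unit p in IS p1 *.
set x := quat_re p in p1 *; set y := `|quat_im p| in p1 *.
have [al [be st]] := stem_exists es IS p1.
have n0 : slice_pt I (`|al| ^+ 2 - `|be| ^+ 2) (2 * quat_re (al * quat_conj be)) != 0.
  apply: stem_norm_value_neq0 => // J JS.
  by rewrite -(stem_qsum st JS); apply: nz; rewrite (slice_pt_norm_eq _ _ JS IS).
set n := slice_pt _ _ _ in n0.
(* The candidate k^-1 p k works as soon as k al + I k be = 1, because the series there equals k^-1.
   This [k] is the value at p of the regular reciprocal: the conjugate series divided by the
   symmetrization. *)
pose k := n^-1 * (quat_conj al + I * quat_conj be).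
have In : I * n^-1 = n^-1 * I.
  have nI : I * n = n * I by exact: slice_comm.
  have nu : n \is a GRing.unit by [].
  apply: (mulrI nu); rewrite mulrA mulrV // mul1r [LHS]mulrA -nI -mulrA mulrV //.
  exact: mulr1.
have kE : (quat_conj al + I * quat_conj be) * al
    + I * ((quat_conj al + I * quat_conj be) * be) = n.
  transitivity (quat_conj al * al - quat_conj be * be
      + I * (quat_conj al * be + quat_conj be * al)).
    have IIb : I * (I * (quat_conj be * be)) = - (quat_conj be * be).
      by rewrite mulrA (imag_sphere_mul IS) mulN1r.
    rewrite [_ * al]mulrDl [_ * be]mulrDl ![I * (_ + _)]mulrDr -2!mulrA IIb.
    by apply: quatP => /=; ring.
  have -> : quat_conj al * be + quat_conj be * al = (2 * quat_re (al * quat_conj be))%:A.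
    by case: (al) (be) => [? ? ? ?] [? ? ? ?]; apply: quatP => /=; ring.
  by rewrite !quat_conj_mul /n /slice_pt scalerBl -scalerAr mulr1.
have k1 : k * al + I * k * be = 1.
  by rewrite /k [I * (_ * _)]mulrA In -!mulrA -mulrDr kE mulVr.
have k0 : k != 0.
  by apply/eqP => k0; move: k1; rewrite k0 mulr0 !mul0r addr0 => /esym/eqP; rewrite oner_eq0.
clearbody k; exists (k^-1 * slice_pt I x y * k); first exact: conjV_norm.
suff -> : qsum e (k^-1 * slice_pt I x y * k) = k^-1.
  by rewrite invrK -!mulrA mulVKr // mulrV // mulr1.
apply: qsum_unique.
have h := cvgn_quatM (x := k^-1) (y := 1) (stem_twist (k := k) st IS).
rewrite k1 !mulr1 in h; apply: cvg_trans h; apply: near_eq_cvg; apply: nearW => N; rewrite mulr1 mulr_sumr.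
by apply: eq_bigr => m _; rewrite conjVX // !mulrA.
Qed.

End Stem.

(** * Discrete circle means *)

Section Trig.
Variable R : realType.
Implicit Types (A B : nat -> R) (th c s : R) (K M m n : nat).

Definition root_angle M (j : nat) : R := j%:R * (pi *+ 2 / M%:R).

Lemma sin_nat_pi c k : sin (c + k%:R * (pi *+ 2)) = sin c :> R.
Proof.
elim: k => [|k IH]; first by rewrite mul0r addr0.
by rewrite -natr1 mulrDl mul1r addrA sinD2pi.
Qed.

(** For k > 0, multiplication by 2 sin (ph/2) makes the sum telescope to a difference of sines k
    full turns apart; k < M keeps ph/2 in (0, pi), where the sine does not vanish. *)
Lemma sum_cos_root_angle M k c : (k < M)%N ->
  \sum_(j < M) cos (c + k%:R * root_angle M j) = if k == 0%N then M%:R * cos c else 0.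
Proof.
case: k => [|k] kM /=.
  under eq_bigr do rewrite mul0r addr0.
  by rewrite sumr_const card_ord mulr_natl.
set ph : R := k.+1%:R * (pi *+ 2 / M%:R).
have M0 : (0 : R) < M%:R by rewrite ltr0n (leq_ltn_trans _ kM).
have s0 : 0 < sin (ph / 2).
  have phE : ph / 2 = pi * (k.+1%:R / M%:R).
    by rewrite /ph -mulr_natr; field; rewrite gt_eqF.
  have p0 := pi_gt0 R; have r0 : (0 : R) < k.+1%:R / M%:R by rewrite divr_gt0.
  apply: sin_gt0_pi; rewrite phE mulr_gt0 //= gtr_pMr //.
  by rewrite ltr_pdivrMr // mul1r ltr_nat.
have s1 : sin (ph / 2) != 0 by rewrite gt_eqF.
have two0 : (2 : R) != 0 by rewrite pnatr_eq0.
apply: (mulfI s1); apply: (mulfI two0).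
rewrite !mulr0 mulrA mulr_sumr.
pose F j := sin (c + j%:R * ph - ph / 2).
transitivity (\sum_(0 <= j < M) (F j.+1 - F j)).
  rewrite big_mkord; apply: eq_bigr => j _; rewrite /root_angle [k.+1%:R * _]mulrCA -/ph.
  have -> : F j.+1 = sin (c + j%:R * ph + ph / 2) by rewrite /F -natr1; congr sin; field.
  rewrite /F sinD sinB; ring.
rewrite telescope_sumr // /F mul0r addr0.
have -> : M%:R * ph = k.+1%:R * (pi *+ 2) by rewrite /ph; field; rewrite gt_eqF.
by rewrite addrAC sin_nat_pi subrr.
Qed.

Lemma sum_sin_root_angle M k c : (k < M)%N ->
  \sum_(j < M) sin (c + k%:R * root_angle M j) = if k == 0%N then M%:R * sin c else 0.
Proof.
move=> kM; have cs x : sin x = cos (x - pi / 2) :> R.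
  by rewrite -[x in LHS](subrK (pi / 2)) sinDpihalf.
rewrite cs -sum_cos_root_angle //; apply: eq_bigr => j _.
by rewrite cs; congr cos; ring.
Qed.

Definition trig A B K th : R :=
  \sum_(n < K) (A n * cos (n%:R * th) + B n * sin (n%:R * th)).

(** Discrete orthogonality. With K + K nodes the frequencies n + m and |n - m| both stay below the
    number of nodes, so nothing is aliased. *)
Lemma sum_cosM_root_angle K n m th : (n < K)%N -> (m < K)%N ->
  \sum_(j < K + K) cos (n%:R * root_angle (K + K) j)
                 * cos (m%:R * (th - root_angle (K + K) j)) =
  if n == m then (if m == 0%N then (K + K)%:R else K%:R * cos (m%:R * th)) else 0.
Proof.
move=> nK mK; set M := (K + K)%N.
have nM : (n < M)%N by rewrite ltn_addr.
have mM : (m < M)%N by rewrite ltn_addr.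
have nmM : (n + m < M)%N by rewrite -addSn leq_add // ltnW.
have two0 : (2 : R) != 0 by rewrite pnatr_eq0.
apply: (mulfI two0).
transitivity (\sum_(j < M) cos (- (m%:R * th) + (n + m)%:R * root_angle M j) +
   if (n <= m)%N then \sum_(j < M) cos (- (m%:R * th) + (m - n)%:R * root_angle M j)
   else \sum_(j < M) cos (m%:R * th + (n - m)%:R * root_angle M j)).
  have e1 x y : 2 * (cos x * cos y) = cos (x - y) + cos (x + y) :> R.
    by rewrite cosB cosD; ring.
  case: leqP => nm; rewrite mulr_sumr -big_split; apply: eq_bigr => j _ /=; rewrite e1.
    congr (cos _ + _); first by rewrite natrD; ring.
    by rewrite -cosN natrB //; congr cos; ring.
  congr (cos _ + cos _); first by rewrite natrD; ring.
  by rewrite natrB 1?ltnW //; ring.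
rewrite sum_cos_root_angle //.
have [->|nm] := eqVneq n m.
  rewrite leqnn subnn sum_cos_root_angle ?(leq_ltn_trans _ mM) //= addnn double_eq0.
  rewrite cosN; case: eqP => [->|_]; first by rewrite mul0r cos0; ring.
  by rewrite /M natrD; ring.
rewrite addn_eq0; have -> : (n == 0%N) && (m == 0%N) = false.
  by apply/negbTE/negP => /andP[/eqP n0 /eqP m0]; rewrite n0 m0 eqxx in nm.
rewrite add0r mulr0; case: leqP => h.
  rewrite sum_cos_root_angle ?(leq_ltn_trans (leq_subr _ _)) // subn_eq0.
  by rewrite leqNgt ltn_neqAle nm h.
rewrite sum_cos_root_angle ?(leq_ltn_trans (leq_subr _ _)) // subn_eq0.
by rewrite leqNgt h.
Qed.

Lemma sum_sinM_root_angle K n m th : (n < K)%N -> (m < K)%N ->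
  \sum_(j < K + K) sin (n%:R * root_angle (K + K) j)
                 * cos (m%:R * (th - root_angle (K + K) j)) =
  if n == m then K%:R * sin (m%:R * th) else 0.
Proof.
move=> nK mK; set M := (K + K)%N.
have nM : (n < M)%N by rewrite ltn_addr.
have mM : (m < M)%N by rewrite ltn_addr.
have nmM : (n + m < M)%N by rewrite -addSn leq_add // ltnW.
have two0 : (2 : R) != 0 by rewrite pnatr_eq0.
apply: (mulfI two0).
transitivity (\sum_(j < M) sin (- (m%:R * th) + (n + m)%:R * root_angle M j) +
   if (n <= m)%N then - \sum_(j < M) sin (- (m%:R * th) + (m - n)%:R * root_angle M j)
   else \sum_(j < M) sin (m%:R * th + (n - m)%:R * root_angle M j)).
  have e1 x y : 2 * (sin x * cos y) = sin (x - y) + sin (x + y) :> R.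
    by rewrite sinB sinD; ring.
  case: leqP => nm; rewrite ?sumrN mulr_sumr -?sumrN -big_split; apply: eq_bigr => j _ /=; rewrite e1.
    congr (sin _ + _); first by rewrite natrD; ring.
    by rewrite -sinN natrB //; congr sin; ring.
  congr (sin _ + sin _); first by rewrite natrD; ring.
  by rewrite natrB 1?ltnW //; ring.
rewrite sum_sin_root_angle //.
have [->|nm] := eqVneq n m.
  rewrite leqnn subnn sum_sin_root_angle ?(leq_ltn_trans _ mM) //= addnn double_eq0.
  rewrite sinN; case: eqP => [->|_]; first by rewrite mul0r sin0; ring.
  by rewrite /M natrD; ring.
rewrite addn_eq0; have -> : (n == 0%N) && (m == 0%N) = false.
  by apply/negbTE/negP => /andP[/eqP n0 /eqP m0]; rewrite n0 m0 eqxx in nm.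
rewrite add0r mulr0; case: leqP => h.
  rewrite sum_sin_root_angle ?(leq_ltn_trans (leq_subr _ _)) // subn_eq0.
  by rewrite leqNgt ltn_neqAle nm h /= oppr0.
rewrite sum_sin_root_angle ?(leq_ltn_trans (leq_subr _ _)) // subn_eq0.
by rewrite leqNgt h.
Qed.

Lemma trig_avg A B K m th : (m < K)%N ->
  \sum_(j < K + K) trig A B K (root_angle (K + K) j)
                 * cos (m%:R * (th - root_angle (K + K) j)) =
  K%:R * (if m == 0%N then 2 * A 0%N
          else A m * cos (m%:R * th) + B m * sin (m%:R * th)).
Proof.
move=> mK; rewrite /trig.
under eq_bigr do rewrite mulr_suml.
rewrite exchange_big /= (bigD1 (Ordinal mK)) //= [X in _ + X]big1 ?addr0.
  under eq_bigr do rewrite mulrDl -!mulrA.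
  rewrite big_split -!mulr_sumr /= sum_cosM_root_angle // sum_sinM_root_angle //.
  rewrite eqxx; case: eqP => [->|_]; first by rewrite mul0r sin0 natrD; ring.
  ring.
move=> n /eqP nm; under eq_bigr do rewrite mulrDl -!mulrA.
rewrite big_split -!mulr_sumr /= sum_cosM_root_angle // sum_sinM_root_angle //.
case: eqP => [h|]; last by rewrite !mulr0 addr0.
by case: nm; apply: val_inj.
Qed.

(** Cauchy's estimate with a finite mean at th = 0; the 2 is there because a squared cosine has mean
    one half. *)
Lemma trig_coef_bound A K m C : (m < K)%N ->
  (forall th, `|trig A (fun=> 0) K th| <= C) -> `|A m| <= 2 * C.
Proof.
move=> mK AC; have K0 : (0 : R) < K%:R by rewrite ltr0n (leq_ltn_trans _ mK).
have C0 : 0 <= C by apply: le_trans (AC 0).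
have h : `|\sum_(j < K + K) trig A (fun=> 0) K (root_angle (K + K) j)
                 * cos (m%:R * (0 - root_angle (K + K) j))| <= (K + K)%:R * C.
  apply: le_trans (ler_norm_sum _ _ _) _.
  apply: (@le_trans _ _ (\sum_(j < K + K) C)); last first.
    by rewrite sumr_const card_ord mulr_natl.
  apply: ler_sum => j _; rewrite normrM -[leRHS]mulr1; apply: ler_pM => //.
  by rewrite ler_norml cos_geN1 cos_le1.
move: h; rewrite trig_avg // mulr0 cos0 mulr1 mul0r addr0 normrM ger0_norm ?(ltW K0) //.
have -> : (K + K)%:R * C = K%:R * (2 * C) by rewrite natrD; ring.
rewrite ler_pM2l //.
case: eqP => [-> |_ //]; rewrite normrM ger0_norm // ler_pM2l ?ltr0n // => h.
by apply: le_trans h _; rewrite ler_peMl // ler1n.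
Qed.

End Trig.

(** * A Harnack inequality *)

Section Harnack.
Variable R : realType.
Implicit Types (A B t : nat -> R) (th s be del : R) (K L m : nat).

Lemma trig_avg_sum A B t K th :
  \sum_(j < K + K) trig A B K (root_angle R (K + K) j)
     * trig t (fun=> 0) K (th - root_angle R (K + K) j) =
  K%:R * \sum_(m < K) t m * (if nat_of_ord m == 0%N then 2 * A 0%N
          else A m * cos (m%:R * th) + B m * sin (m%:R * th)).
Proof.
transitivity (\sum_(j < K + K) \sum_(m < K) t m * (trig A B K (root_angle R (K + K) j)
     * cos (m%:R * (th - root_angle R (K + K) j)))).
  apply: eq_bigr => j _; rewrite [X in _ * X]/trig mulr_sumr.
  by apply: eq_bigr => m _; rewrite mul0r addr0 mulrCA.
rewrite exchange_big mulr_sumr /=; apply: eq_bigr => m _.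
by rewrite -mulr_sumr trig_avg // mulrCA.
Qed.

(** Multiplied by the Poisson denominator, the truncated series is exact up to two boundary terms;
    the induction is the three-term recurrence of cos (m ph). *)
Lemma poisson_trunc s ph K : (1 + s ^+ 2 - 2 * s * cos ph)
  * (\sum_(m < K.+1) (if nat_of_ord m == 0%N then 1 else 2 * s ^+ m) * cos (m%:R * ph)) =
  1 - s ^+ 2 - 2 * s ^+ K.+1 * cos (K.+1%:R * ph) + 2 * s ^+ K.+2 * cos (K%:R * ph).
Proof.
elim: K => [|K IH].
  by rewrite big_ord_recl big_ord0 /= !mul0r cos0 !mul1r; ring.
rewrite big_ord_recr /= mulrDr IH.
have h : cos (K.+2%:R * ph) = 2 * cos ph * cos (K.+1%:R * ph) - cos (K%:R * ph).
  have -> : K.+2%:R * ph = K.+1%:R * ph + ph by rewrite -[K.+2%:R]natr1; ring.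
  have -> : K%:R * ph = K.+1%:R * ph - ph by rewrite -[K.+1%:R]natr1; ring.
  by rewrite cosD cosB; ring.
by rewrite h !exprS; ring.
Qed.

(* Truncated Poisson kernel minus its tangent line, as a convex function of
   cos ph, at cos ph = - be / 2. *)
Section TangentKernel.
Variables (s be : R).
Hypotheses (s0 : 0 < s) (s1 : s < 1) (be0 : 0 <= be).
(** [X0] is the Poisson denominator where the cosine equals - be / 2; [ca] and [cb] are the
    intercept and the slope of the tangent there. *)
Let X0 := 1 + s ^+ 2 + s * be.
Let ca := (1 - s ^+ 2) * (2 * X0 - (1 + s ^+ 2)) / X0 ^+ 2.
Let cb := 2 * s * (1 - s ^+ 2) / X0 ^+ 2.
Let ker m : R := (if m == 0%N then 1 else 2 * s ^+ m)
  - (if m == 0%N then ca else if m == 1%N then cb else 0).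

Let X0_gt0 : 0 < X0.
Proof. by rewrite /X0; have := sqr_ge0 s; have := mulr_ge0 (ltW s0) be0; lra. Qed.

Let s2 : 0 < 1 - s ^+ 2.
Proof. by rewrite subr_gt0 expr2 mulr_ilt1 // ltW. Qed.

Lemma tangent_kernel_ge L ph :
  - (4 * s ^+ L.+2 / (1 - s) ^+ 2) <= trig ker (fun=> 0) L.+2 ph.
Proof.
pose X := 1 + s ^+ 2 - 2 * s * cos ph.
have d0 : 0 < 1 - s by rewrite subr_gt0.
have dX : (1 - s) ^+ 2 <= X.
  rewrite /X; have := cos_le1 ph; move: (cos ph) => c c1.
  have := mulr_ge0 (ltW s0) (_ : 0 <= 1 - c); rewrite subr_ge0 => /(_ c1); nra.
have X0' : 0 < X by apply: lt_le_trans dX; rewrite exprn_gt0.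
have -> : trig ker (fun=> 0) L.+2 ph =
    (\sum_(m < L.+2) (if nat_of_ord m == 0%N then 1 else 2 * s ^+ m) * cos (m%:R * ph))
    - ca - cb * cos ph.
  rewrite /trig; under eq_bigr do rewrite mul0r addr0 mulrBl.
  rewrite sumrB -addrA -opprD; congr (_ - _).
  rewrite !big_ord_recl /= big1 => [|i _]; last by rewrite mul0r.
  by rewrite mul0r cos0 mulr1 mul1r addr0.
have P := poisson_trunc s ph L.+1; rewrite -/X in P; set S := \sum_(m < _) _ in P *.
(* Truncation error of the kernel: the numerator is at most 4 s^(L+2) and the denominator at least
   (1 - s)^2. *)
pose E := (- 2 * s ^+ L.+2 * cos (L.+2%:R * ph)
    + 2 * s ^+ L.+3 * cos (L.+1%:R * ph)) / X.
have SE : S = (1 - s ^+ 2) / X + E.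
  rewrite /E -mulrDl; have Xn : X != 0 by rewrite gt_eqF.
  apply: (mulfI Xn); rewrite P; field.
  by rewrite gt_eqF.
(* Convexity made explicit: the kernel minus its tangent is a square times positive factors. *)
have sq : (1 - s ^+ 2) / X - ca - cb * cos ph
    = (1 - s ^+ 2) * (X0 - X) ^+ 2 / (X * X0 ^+ 2).
  rewrite /ca /cb /X; field; rewrite -/X !gt_eqF //.
have sq0 : 0 <= (1 - s ^+ 2) / X - ca - cb * cos ph.
  by rewrite sq; apply: divr_ge0; rewrite mulr_ge0 ?sqr_ge0 ?(ltW s2) ?(ltW X0').
rewrite SE; suff : - (4 * s ^+ L.+2 / (1 - s) ^+ 2) <= E by lra.
suff : `|E| <= 4 * s ^+ L.+2 / (1 - s) ^+ 2 by rewrite ler_norml => /andP[].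
rewrite /E normrM normfV (ger0_norm (ltW X0')); apply: ler_pM => //.
- by rewrite invr_ge0 ltW.
- apply: le_trans (ler_normD _ _) _.
  have c1 x : `|cos x| <= 1 :> R by rewrite ler_norml cos_geN1 cos_le1.
  have p0 : 0 <= s ^+ L.+2 by rewrite exprn_ge0 // ltW.
  have two0 : (0 : R) <= 2 by [].
  rewrite [s ^+ L.+3]exprS; move: (s ^+ L.+2) p0 => p p0.
  rewrite !normrM normrN (ger0_norm p0) (ger0_norm (ltW s0)) (ger0_norm two0).
  have := c1 (L.+2%:R * ph); have := c1 (L.+1%:R * ph).
  have := normr_ge0 (cos (L.+2%:R * ph)); have := normr_ge0 (cos (L.+1%:R * ph)).
  move: `|cos _| `|cos _| => u v u0 v0 u1 v1.
  have := ler_wpM2l p0 u1; have := ler_wpM2l p0 v1; rewrite !mulr1.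
  have := mulr_ge0 p0 u0; move: s0 s1; nra.
- by rewrite lef_pV2 // posrE exprn_gt0.
Qed.

(** [del] admits a trigonometric polynomial that is nonnegative only up to truncation. It and the
    kernel are shifted to be nonnegative; the node sum of their product then expands into the wanted
    value, the tangent coefficients and the first harmonic, whose lower bound is a hypothesis. *)
Lemma trig_harnack A B L th del : A 0%N = 1 ->
  - be <= A 1%N * cos th + B 1%N * sin th -> 0 <= del ->
  (forall x, - del <= trig A B L.+2 x) ->
  (1 - s ^+ 2) / X0 <=
    trig (fun n => s ^+ n * A n) (fun n => s ^+ n * B n) L.+2 th
    + (del + (1 + del) * (4 * s ^+ L.+2 / (1 - s) ^+ 2)).
Proof.
move=> A0 W1 del0 Ud; set eps := 4 * _ / _; set U := trig _ _ _ th.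
have eps0 : 0 <= eps by apply: divr_ge0; rewrite ?exprn_ge0 ?subr_ge0 ?(ltW s1) // mulr_ge0 ?exprn_ge0 ?(ltW s0).
pose K := L.+2; pose x j := root_angle R (K + K) j.
have pos : 0 <= \sum_(j < K + K) (trig A B K (x j) + del)
     * (trig ker (fun=> 0) K (th - x j) + eps).
  apply: sumr_ge0 => j _; apply: mulr_ge0; first by have := Ud (x j); rewrite -/K; lra.
  by have := tangent_kernel_ge L (th - x j); rewrite -/eps -/K; lra.
have S1 : \sum_(j < K + K) trig A B K (x j) * trig ker (fun=> 0) K (th - x j)
   = K%:R * (2 * U - 2 * ca - cb * (A 1%N * cos th + B 1%N * sin th)).
  rewrite trig_avg_sum; congr (_ * _); rewrite /U /trig mulr_sumr /K.
  rewrite !big_ord_recl /= A0 !mul0r cos0 sin0 !mul1r !mulr1.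
  rewrite [X in _ + (_ + X) = _](_ : _ = \sum_(i < L) 2 *
     (s ^+ bump 0 (bump 0 i) * A (bump 0 (bump 0 i)) * cos ((bump 0 (bump 0 i))%:R * th) +
      s ^+ bump 0 (bump 0 i) * B (bump 0 (bump 0 i)) * sin ((bump 0 (bump 0 i))%:R * th))).
    have b1 : bump 0 0 = 1%N by [].
    by rewrite /ker /= !b1 !expr1; ring.
  apply: eq_bigr => i _; rewrite (_ : bump 0 (bump 0 i) = i.+2) // /ker /=; ring.
have S2 : \sum_(j < K + K) trig ker (fun=> 0) K (th - x j) = K%:R * (2 * (1 - ca)).
  have one j : trig (fun n => (n == 0%N)%:R) (fun=> 0) K (x j) = 1.
    rewrite /trig big_ord_recl /= mul0r cos0 mul0r addr0 mulr1 big1 ?addr0 //.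
    by move=> i _; rewrite !mul0r addr0.
  transitivity (\sum_(j < K + K) trig (fun n => (n == 0%N)%:R) (fun=> 0) K (x j)
     * trig ker (fun=> 0) K (th - x j)).
    by apply: eq_bigr => j _; rewrite one mul1r.
  rewrite trig_avg_sum; congr (_ * _).
  rewrite big_ord_recl /= /ker /= big1 ?addr0 ?mulr1 1?mulrC // => i _.
  by rewrite !mul0r addr0 mulr0.
have S3 : \sum_(j < K + K) trig A B K (x j) = K%:R * 2.
  have := @trig_avg R A B K 0 th isT; rewrite /= A0 mulr1 => <-.
  by apply: eq_bigr => j _; rewrite mul0r cos0 mulr1.
have S4 : \sum_(j < K + K) (trig A B K (x j) + del)
     * (trig ker (fun=> 0) K (th - x j) + eps) =
   K%:R * (2 * U - 2 * ca - cb * (A 1%N * cos th + B 1%N * sin th)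
     + del * (2 * (1 - ca)) + eps * 2 + 2 * (del * eps)).
  under eq_bigr do rewrite mulrDl !mulrDr.
  rewrite !big_split /= S1 -mulr_suml S3 -mulr_sumr S2 sumr_const card_ord.
  by rewrite -[del * eps *+ _]mulr_natl natrD; ring.
rewrite S4 pmulr_rge0 ?ltr0n // in pos.
have ca0 : 0 <= ca.
  apply: divr_ge0; last by rewrite exprn_ge0 // ltW.
  rewrite mulr_ge0 ?(ltW s2) // /X0; have := mulr_ge0 (ltW s0) be0.
  have := sqr_ge0 s; lra.
have cb0 : 0 <= cb.
  by rewrite /cb !mulr_ge0 ?invr_ge0 ?exprn_ge0 // ltW.
(* The tangent meets the Poisson kernel at - be / 2. *)
have tang : (1 - s ^+ 2) / X0 = ca - cb / 2 * be.
  by rewrite /ca /cb /X0; field; rewrite -/X0 gt_eqF.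
rewrite tang; have := ler_wpM2l cb0 W1; have := mulr_ge0 del0 ca0; lra.
Qed.

End TangentKernel.
End Harnack.

(** * Inverting a power series without zeros *)

Section FormalInverse.
Variable K : comNzRingType.
Implicit Types (nu de a b : nat -> K).

Lemma cauchy_prodC a b : cauchy_prod a b = cauchy_prod b a.
Proof.
by apply/funext => n; rewrite !(@cauchy_prod_polyE _ _ _ n n.+1) // mulrC.
Qed.

(** Each coefficient needs all earlier ones, hence a recursion that carries the whole list. *)
Fixpoint inverse_coefs nu n : seq K :=
  if n is m.+1 then let s := inverse_coefs nu m in
    rcons s ((m == 0%N)%:R - \sum_(k < m) nu (m - k)%N * s`_k)
  else [::].

Lemma size_inverse_coefs nu n : size (inverse_coefs nu n) = n.
Proof. by elim: n => //= n IH; rewrite size_rcons IH. Qed.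

Lemma formal_inverse nu : nu 0%N = 1 -> exists de, cauchy_prod nu de = @cauchy_one K.
Proof.
move=> nu0; pose de n := (inverse_coefs nu n.+1)`_n; exists de.
have deE n k : (k < n)%N -> (inverse_coefs nu n)`_k = de k.
  elim: n => // n IH; rewrite ltnS leq_eqVlt => /orP[/eqP -> //|kn].
  by rewrite /= nth_rcons size_inverse_coefs kn IH.
apply/funext => n; rewrite cauchy_prodC /cauchy_prod big_ord_recr /= subnn nu0 mulr1.
rewrite {2}/de /= nth_rcons size_inverse_coefs ltnn eqxx.
rewrite [X in _ + (_ - X)](_ : _ = \sum_(i < n) de i * nu (n - i)%N).
  by rewrite addrC subrK.
by apply: eq_bigr => i _; rewrite deE // mulrC.
Qed.

(** Restricted to indices below [L] so that a series can be compared with its truncation: their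
    inverses share the first [L] coefficients. *)
Lemma formal_inverse_unique nu nu' de de' L : nu 0%N = 1 -> nu' 0%N = 1 ->
  (forall n, (n < L)%N -> nu n = nu' n) ->
  (forall n, (n < L)%N -> cauchy_prod nu de n = cauchy_prod nu' de' n) ->
  forall n, (n < L)%N -> de n = de' n.
Proof.
move=> n0 n0' nn' cc' n; elim/ltn_ind: n => n IH nL.
have := cc' n nL; rewrite /cauchy_prod !big_ord_recl /= subn0 n0 n0' !mul1r => h.
apply: (addIr (\sum_(i < n) nu (bump 0 i) * de (n - bump 0 i)%N)); rewrite h.
congr (_ + _); apply: eq_bigr => i _; have iN := ltn_ord i.
rewrite nn' ?IH //; rewrite /bump /= add1n; first by rewrite ltn_subrL /= (leq_ltn_trans _ iN).
- by rewrite (leq_ltn_trans (leq_subr _ _)).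
- by rewrite (leq_ltn_trans iN).
Qed.

End FormalInverse.

(** * Dividing a summable sequence by linear factors with large roots *)

Section RootSummable.
Variable C : numClosedFieldType.
Implicit Types (w d : nat -> C) (z r : C).

Lemma cauchy_prod_XsubC z w n :
  cauchy_prod (fun k => ('X - z%:P)`_k) w n = (if n is m.+1 then w m else 0) - z * w n.
Proof.
rewrite /cauchy_prod; case: n => [|n].
  by rewrite big_ord_recl big_ord0 /= coefB coefX coefC /= subn0; ring.
rewrite !big_ord_recl /= big1 => [|i _]; last first.
  by rewrite coefB coefX coefC /= subr0 mul0r.
by rewrite !coefB !coefX !coefC /= subn0 subSS subn0; ring.
Qed.

(** Factors are removed one at a time. If y = (X - z) w then |z| |w_n| <= |y_n| + |w_(n-1)|, so S =
    sum |w_n| r^n satisfies |z| S <= Y + r S, and |z| > r bounds S. *)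
Lemma summable_of_roots (s : seq C) d r Y : 0 <= r ->
  (forall z, z \in s -> r < `|z|) ->
  (forall N, \sum_(n < N) `|cauchy_prod (fun k => (\prod_(z <- s) ('X - z%:P))`_k) d n|
       * r ^+ n <= Y) ->
  exists Y', forall N, \sum_(n < N) `|d n| * r ^+ n <= Y'.
Proof.
move=> r0; elim: s Y => [|z s IH] Y sr hY.
  exists Y => N; apply: le_trans (hY N); apply: ler_sum => n _.
  have -> // : cauchy_prod (fun k => (\prod_(z <- [::]) ('X - z%:P))`_k) d n = d n.
  have -> : (fun k => (\prod_(z <- [::]) ('X - z%:P))`_k) = @cauchy_one C.
    by apply/funext => k; rewrite big_nil coef1.
  by rewrite cauchy_prod1.
set w := cauchy_prod (fun k => (\prod_(z <- s) ('X - z%:P))`_k) d in IH.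
have zr : 0 < `|z| - r by rewrite subr_gt0 sr // mem_head.
apply: (IH (Y / (`|z| - r))) => [y ys|N]; first by apply: sr; rewrite inE ys orbT.
have yE n : cauchy_prod (fun k => (\prod_(z0 <- z :: s) ('X - z0%:P))`_k) d n =
    (if n is m.+1 then w m else 0) - z * w n.
  rewrite -cauchy_prod_XsubC /w cauchy_prodA; congr (cauchy_prod _ _ n).
  by apply/funext => k; rewrite big_cons coefM.
rewrite ler_pdivlMr // mulrBr lerBlDr mulrC mulr_sumr.
apply: le_trans (_ : Y + \sum_(n < N) `|if nat_of_ord n is m.+1 then w m else 0| * r ^+ n <= _).
  rewrite -lerBlDr -sumrB; apply: le_trans (hY N); apply: ler_sum => n _.
  rewrite mulrA -mulrBl ler_wpM2r ?exprn_ge0 // yE -normrM distrC.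
  exact: lerB_dist.
rewrite lerD2l; case: N => [|N]; first by rewrite !big_ord0 mul0r.
rewrite big_ord_recl /= normr0 mul0r add0r big_ord_recr /= mulrDl mulr_suml.
rewrite ler_wpDr //; first by rewrite !mulr_ge0 ?exprn_ge0.
by apply: ler_sum => i _; rewrite exprSr mulrA.
Qed.

End RootSummable.

(** * Inverses of truncated real power series on a slice *)

Section RealSeries.
Local Open Scope complex_scope.
Local Open Scope ring_scope.
Variable R : realType.
Local Notation H := (quat R).
Variable I : H.
Hypothesis IS : imag_sphere I.
Implicit Types (nu w : nat -> R) (e : nat -> H) (p q : H) (x y r t th : R) (L K N : nat).

Definition alg_seq nu n : H := (nu n)%:A.

Definition trunc_seq L nu n : R := if (n < L)%N then nu n else 0.

(** Identifies [R[i]] with the slice of [I]: polynomials split in [R[i]], while zeros are excluded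
    on the slice. *)
Let phi (z : R[i]) : H := slice_pt I (complex.Re z) (complex.Im z).

Let phiM z z' : phi (z * z') = phi z * phi z'.
Proof. by case: z z' => [a b] [a' b']; rewrite /phi slice_ptM. Qed.

Let phiD z z' : phi (z + z') = phi z + phi z'.
Proof.
case: z z' => [a b] [a' b']; rewrite /phi /= /slice_pt !scalerDl.
by rewrite addrACA.
Qed.

Let phi_real a : phi a%:C = a%:A.
Proof. by rewrite /phi /= /slice_pt scale0r addr0. Qed.

Let phiX z n : phi (z ^+ n) = phi z ^+ n.
Proof.
elim: n => [|n IH]; last by rewrite !exprS phiM IH.
by rewrite !expr0 -[RHS]scale1r; apply: phi_real.
Qed.

Let phi_sum (F : nat -> R[i]) N : phi (\sum_(n < N) F n) = \sum_(n < N) phi (F n).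
Proof.
elim: N => [|N IH]; last by rewrite !big_ord_recr /= phiD IH.
by rewrite !big_ord0 -[0]/(0%:C) phi_real scale0r.
Qed.

Let phi_norm z : `|z| = `|phi z|%:C.
Proof.
rewrite normc_def; congr (_%:C); apply: (@pexpIrn _ 2); rewrite ?nnegrE ?sqrtr_ge0 //.
by rewrite slice_pt_norm // sqr_sqrtr // addr_ge0 ?sqr_ge0.
Qed.

(** This bound may depend on [L]. It serves to make the error term of [inverse_bound] tend to 0, and
    the uniform bound is obtained there. *)
Lemma inverse_summable nu w L r : nu 0%N = 1 -> (0 < L)%N -> 0 <= r ->
  (forall x y, `|slice_pt I x y| <= r -> psum (alg_seq nu) (slice_pt I x y) L != 0) ->
  cauchy_prod (trunc_seq L nu) w = @cauchy_one R ->
  exists Y, forall N, \sum_(n < N) `|w n| * r ^+ n <= Y.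
Proof.
move=> nu0 L0 r0 nz inv.
pose P := \poly_(i < L) (nu i)%:C.
have [s Ps] := closed_field_poly_normal P.
have P0 : P`_0 = 1 by rewrite coef_poly L0 nu0.
have lc0 : lead_coef P != 0.
  by apply/eqP => /eqP; rewrite lead_coef_eq0 => /eqP h; move: P0; rewrite h coef0 => /esym/eqP; rewrite oner_eq0.
have rt z : z \in s -> r%:C < `|z|.
  move=> zs; rewrite phi_norm ltcR ltNge; apply/negP => zr.
  have /eqP := nz _ _ zr; apply.
  have Pz : P.[z] = 0.
    apply/eqP; rewrite -/(root P z) Ps rootZ // root_prod_XsubC //.
  rewrite horner_poly in Pz; rewrite -/(phi z).
  transitivity (phi (\sum_(i < L) (nu i)%:C * z ^+ i)); last first.
    by rewrite Pz -[0]/(0%:C) phi_real scale0r.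
  rewrite (phi_sum (fun i => (nu i)%:C * z ^+ i)); apply: eq_bigr => i _.
  by rewrite phiM phiX phi_real /alg_seq quat_scalar_comm.
pose wC n := (w n)%:C.
have cP n : cauchy_prod (fun k => P`_k) wC n = @cauchy_one _ n.
  transitivity (cauchy_prod (trunc_seq L nu) w n)%:C.
    rewrite /cauchy_prod rmorph_sum; apply: eq_bigr => k _ /=.
    rewrite rmorphM; congr (_ * _).
    by rewrite coef_poly /trunc_seq; case: ifP.
  by rewrite inv /cauchy_one; case: (n == 0%N).
have cS n : cauchy_prod (fun k => (\prod_(z <- s) ('X - z%:P))`_k) wC n =
    (lead_coef P)^-1 * @cauchy_one _ n.
  apply: (mulfI lc0); rewrite mulrA mulfV // mul1r -cP {2}Ps /cauchy_prod mulr_sumr.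
  by apply: eq_bigr => k _; rewrite coefZ mulrA.
have rC0 : 0 <= r%:C by rewrite ler0c.
have [|Y' hY] := summable_of_roots (d := wC) (Y := `|(lead_coef P)^-1|) rC0 rt.
  case=> [|N]; first by rewrite big_ord0.
  rewrite big_ord_recl [X in _ + X]big1 => [|i _]; last first.
    by rewrite cS /cauchy_one /= mulr0 normr0 mul0r.
  by rewrite cS /cauchy_one /= expr0 !mulr1 addr0.
exists (complex.Re Y') => N; have := hY N.
have -> : \sum_(n < N) `|wC n| * r%:C ^+ n = (\sum_(n < N) `|w n| * r ^+ n)%:C.
  rewrite rmorph_sum; apply: eq_bigr => n _; rewrite rmorphM rmorphXn /=; congr (_ * _).
  by rewrite phi_norm /wC phi_real quat_norm_alg.
by rewrite lecE => /andP[].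
Qed.

Lemma slice_pt_polar r th n :
  slice_pt I (r * cos th) (r * sin th) ^+ n =
  slice_pt I (r ^+ n * cos (n%:R * th)) (r ^+ n * sin (n%:R * th)).
Proof.
elim: n => [|n IH].
  by rewrite !expr0 mul0r cos0 sin0 mulr1 mulr0 /slice_pt scale0r addr0 scale1r.
rewrite exprS IH slice_ptM // -natr1 mulrDl mul1r cosD sinD exprS.
by congr slice_pt; ring.
Qed.

Lemma slice_pt_polar_norm r th : 0 <= r -> `|slice_pt I (r * cos th) (r * sin th)| = r.
Proof.
move=> r0; apply: (@pexpIrn _ 2); rewrite ?nnegrE // slice_pt_norm //.
have := cos2Dsin2 th; move: (cos th) (sin th) => c s h.
by rewrite !exprMn -mulrDr h mulr1.
Qed.

Lemma re_slice_ptM x y p : quat_re (slice_pt I x y * p) =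
  x * quat_re p + y * quat_re (I * p).
Proof. by rewrite /slice_pt mulrDl -!scalerAl mul1r. Qed.

Lemma psum_polar_re e r th K :
  quat_re (psum e (slice_pt I (r * cos th) (r * sin th)) K) =
  trig (fun n => r ^+ n * quat_re (e n)) (fun n => r ^+ n * quat_re (I * e n)) K th.
Proof.
rewrite /psum (quat_re_sum (fun n => slice_pt I _ _ ^+ n * e n)) /trig.
by apply: eq_bigr => n _; rewrite slice_pt_polar re_slice_ptM; ring.
Qed.

Lemma psum_cauchy_one p K : psum (alg_seq (@cauchy_one R)) p K.+1 = 1.
Proof.
rewrite /psum big_ord_recl big1 => [|i _]; last by rewrite /alg_seq scale0r mulr0.
by rewrite expr0 mul1r /alg_seq scale1r addr0.
Qed.

Lemma alg_seq_cauchy_prod nu w :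
  cauchy_prod (alg_seq nu) (alg_seq w) = alg_seq (cauchy_prod nu w).
Proof.
apply/funext => n; rewrite /cauchy_prod /alg_seq scaler_suml; apply: eq_bigr => k _.
by rewrite -scalerAl mul1r scalerA.
Qed.

Lemma psum_trunc nu p L K : (L <= K)%N ->
  psum (alg_seq (trunc_seq L nu)) p K = psum (alg_seq nu) p L.
Proof.
move=> LK; rewrite /psum -(big_mkord xpredT (fun n => p ^+ n * alg_seq (trunc_seq L nu) n)).
rewrite (big_cat_nat (n := L)) //= [X in _ + X]big_nat_cond [X in _ + X]big1 ?addr0.
  by rewrite big_mkord; apply: eq_bigr => i _; rewrite /alg_seq /trunc_seq ltn_ord.
by move=> n /andP[/andP[Ln _] _]; rewrite /alg_seq /trunc_seq ltnNge Ln scale0r mulr0.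
Qed.

(** On the circle of radius [r'] the product of the two partial sums is 1 up to a multiple of
    (r'/r)^K. So the inverse is at most (1 + o(1)) / del there, and Cauchy's estimate gives a bound
    free of [L]. *)
Lemma inverse_bound nu w L r r' del : nu 0%N = 1 -> (0 < L)%N -> 0 < r' -> r' < r -> 0 < del ->
  (forall x y, `|slice_pt I x y| <= r -> del <= `|psum (alg_seq nu) (slice_pt I x y) L|) ->
  cauchy_prod (trunc_seq L nu) w = @cauchy_one R ->
  forall n, `|w n| * r' ^+ n <= 2 / del.
Proof.
move=> nu0 L0 r'0 r'r del0 lb inv n.
have r0 : 0 < r by apply: lt_trans r'r.
have [Y hY] : exists Y, forall N, \sum_(n < N) `|w n| * r ^+ n <= Y.
  apply: (@inverse_summable nu w L r) => //; first exact: ltW.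
  by move=> x y xyr; rewrite -normr_gt0; apply: lt_le_trans (lb _ _ xyr).
have hYH M : \sum_(n < M) `|alg_seq w n| * r ^+ n <= Y.
  by under eq_bigr do rewrite /alg_seq quat_norm_alg.
pose C := \sum_(n < L) `|nu n| * r ^+ n.
have hC M : \sum_(n < M) `|alg_seq (trunc_seq L nu) n| * r ^+ n <= C.
  pose F n := `|alg_seq (trunc_seq L nu) n| * r ^+ n.
  have F0 k : 0 <= F k by rewrite mulr_ge0 ?exprn_ge0 // ltW.
  have -> : C = \sum_(n < L) F n.
    by apply: eq_bigr => k _; rewrite /F /alg_seq /trunc_seq ltn_ord quat_norm_alg.
  rewrite -(big_mkord xpredT F) -(big_mkord xpredT F).
  have [ML|LM] := leqP M L.
    by rewrite [leRHS](big_cat_nat (n := M)) //= lerDl sumr_ge0.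
  rewrite (big_cat_nat (n := L)) ?(ltnW LM) //= [X in _ + X]big_nat_cond [X in _ + X]big1 ?addr0 //.
  move=> k /andP[/andP[Lk _] _].
  by rewrite /F /alg_seq /trunc_seq ltnNge Lk scale0r normr0 mul0r.
pose x := r' / r; have x0 : 0 <= x by rewrite divr_ge0 // ltW.
have x1 : x < 1 by rewrite ltr_pdivrMr // mul1r.
have inv' : cauchy_prod (alg_seq w) (alg_seq (trunc_seq L nu)) = alg_seq (@cauchy_one R).
  by rewrite alg_seq_cauchy_prod cauchy_prodC inv.
apply: (ler_of_cvg0 (v := fun K => (2 / del * (Y * C)) * x ^+ K)); first exact: cvg_geometric_mul.
exists (L + n.+1)%N => // K /= LK; have LK' : (L <= K)%N by apply: leq_trans LK; apply: leq_addr.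
have nK : (n < K)%N by apply: leq_trans LK; apply: leq_addl.
have -> : 2 / del + 2 / del * (Y * C) * x ^+ K = 2 * ((1 + Y * C * x ^+ K) / del).
  by field; rewrite gt_eqF.
have wn : `|w n| * r' ^+ n = `|r' ^+ n * w n|.
  by rewrite mulrC normrM [`|r' ^+ n|]ger0_norm // exprn_ge0 // ltW.
rewrite wn; apply: (@trig_coef_bound _ (fun n => r' ^+ n * w n) K) => // th.
pose p := slice_pt I (r' * cos th) (r' * sin th).
have pr' : `|p| = r' by rewrite slice_pt_polar_norm // ltW.
have pr : `|p| <= r by rewrite pr' ltW.
have -> : trig (fun n => r' ^+ n * w n) (fun=> 0) K th = quat_re (psum (alg_seq w) p K).
  rewrite /p psum_polar_re; apply: eq_bigr => k _.
  have e1 : quat_re (alg_seq w k) = w k by rewrite /= mulr1.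
  have e2 : quat_re (I * alg_seq w k) = 0.
    by rewrite /alg_seq -scalerAr mulr1 quat_reZ ((imag_sphereP I).1 IS).1 mulr0.
  by rewrite e1 e2; ring.
apply: le_trans (quat_re_norm _) _; rewrite ler_pdivlMr //.
apply: (@le_trans _ _ (`|psum (alg_seq w) p K| * `|psum (alg_seq nu) p L|)).
  by rewrite ler_wpM2l // lb.
rewrite -quat_normM.
have h := cauchy_product_dist K r0 pr hYH hC.
rewrite inv' pr' -/x in h.
have K1 : K = K.-1.+1 by rewrite prednK // (leq_ltn_trans _ nK).
rewrite K1 psum_cauchy_one -K1 in h.
(* Real coefficients are central, so the inserted partial sum can be pulled out and an ordinary
   product remains. *)
have sE : \sum_(m < K) p ^+ m * psum (alg_seq w) p K * alg_seq (trunc_seq L nu) m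
    = psum (alg_seq nu) p L * psum (alg_seq w) p K.
  rewrite -(psum_trunc nu p LK') {2}/psum mulr_suml; apply: eq_bigr => m _.
  by rewrite /alg_seq -!mulrA quat_scalar_comm.
rewrite sE in h; rewrite quat_normM mulrC -quat_normM.
have -> : psum (alg_seq nu) p L * psum (alg_seq w) p K
   = 1 - (1 - psum (alg_seq nu) p L * psum (alg_seq w) p K) by rewrite opprB addrC subrK.
by apply: le_trans (ler_normB _ _) _; rewrite quat_norm1 lerD2l.
Qed.

End RealSeries.

(** * Uniform lower bounds for partial sums on a closed disc *)

Section LowerBound.
Variable R : realType.
Local Notation H := (quat R).
Implicit Types (e d : nat -> H) (p q I : H) (x y r t : R) (L K N : nat).

(** The factor [t] on the left stands in for an exponent n - 1 on the right. *)
Lemma expr_lipschitz p q t n : `|p| <= t -> `|q| <= t ->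
  t * `|p ^+ n - q ^+ n| <= n%:R * t ^+ n * `|p - q|.
Proof.
move=> pt qt; have t0 : 0 <= t by apply: le_trans pt.
elim: n => [|n IH]; first by rewrite !expr0 subrr normr0 mulr0 !mul0r.
have -> : p ^+ n.+1 - q ^+ n.+1 = p * (p ^+ n - q ^+ n) + (p - q) * q ^+ n.
  by rewrite mulrBr mulrBl addrA subrK -!exprS.
apply: le_trans (ler_wpM2l t0 (ler_normD _ _)) _.
rewrite mulrDr !quat_normM quat_normX -natr1 !mulrDl mul1r; apply: lerD.
  apply: (@le_trans _ _ (t * (t * `|p ^+ n - q ^+ n|))).
    by rewrite ler_wpM2l // ler_wpM2r.
  by apply: le_trans (ler_wpM2l t0 IH) _; rewrite exprS le_eqVlt; apply/orP; left; apply/eqP; ring.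
rewrite exprS -mulrA ler_wpM2l // mulrC ler_wpM2r //.
by apply: lerXn2r; rewrite ?nnegrE.
Qed.

Lemma psum_lipschitz e p q t C N : `|p| <= t -> `|q| <= t ->
  (forall M, \sum_(n < M) `|n%:R *: e n| * t ^+ n <= C) ->
  t * `|psum e p N - psum e q N| <= C * `|p - q|.
Proof.
move=> pt qt hC; have t0 : 0 <= t by apply: le_trans pt.
apply: le_trans (_ : _ <= (\sum_(n < N) `|n%:R *: e n| * t ^+ n) * `|p - q|) _; last first.
  by rewrite ler_wpM2r.
rewrite /psum -sumrB; apply: le_trans (ler_wpM2l t0 (ler_norm_sum _ _ _)) _.
rewrite mulr_sumr mulr_suml; apply: ler_sum => n _.
rewrite -mulrBl quat_normM mulrA normrZ normr_nat.
apply: le_trans (ler_wpM2r (normr_ge0 _) (expr_lipschitz n pt qt)) _.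
by rewrite le_eqVlt; apply/orP; left; apply/eqP; ring.
Qed.

Lemma slice_ptB I x y x' y' : slice_pt I x y - slice_pt I x' y' = slice_pt I (x - x') (y - y').
Proof. by rewrite /slice_pt opprD addrACA -!scalerBl. Qed.

Lemma slice_pt_norm_le I x y : imag_sphere I -> `|slice_pt I x y| <= `|x| + `|y|.
Proof.
move=> IS; apply: le_trans (ler_normD _ _) _.
by rewrite quat_norm_alg normrZ (imag_sphere_norm IS) mulr1.
Qed.

Lemma psum_lower_bound e I r : pow_summable e -> imag_sphere I -> 0 < r -> r < 1 ->
  (forall x y, `|slice_pt I x y| < 1 -> qsum e (slice_pt I x y) != 0) ->
  exists k, forall L, (k <= L)%N -> forall x y, `|slice_pt I x y| <= r ->
    k.+1%:R^-1 <= `|psum e (slice_pt I x y) L|.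
Proof.
move=> es IS r0 r1 nz.
(* One index [k] is both the threshold on [L] and the lower bound 1/(k+1), so the compactness
   argument runs along a single filter. Outside the disc [P] is vacuous, which lets the compact set
   be a square. *)
pose P k (xy : R * R) := forall L, (k <= L)%N -> `|slice_pt I xy.1 xy.2| <= r ->
  k.+1%:R^-1 <= `|psum e (slice_pt I xy.1 xy.2) L|.
have cpt : compact (`[- r, r]%classic `*` `[- r, r]%classic).
  by apply: compact_setX; apply: segment_compact.
have [C hC] := pow_summableZn es r0 r1.
have C0 : 0 <= C by have := hC 0%N; rewrite big_ord0.
have nearP (xy : R * R) : \forall x' \near xy & k \near \oo, P k x'.
  case: xy => a b; set p0 := slice_pt I a b.
  suff [ep ep0 [k hk]] : exists2 ep : R, 0 < ep & exists k0, forall k, (k0 <= k)%N -> forall x y,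
      `|p0 - slice_pt I x y| <= ep -> P k (x, y).
    exists (ball (a, b) (ep / 2), [set n | (k <= n)%N]).
      by split => /=; [apply: nbhsx_ballx; rewrite divr_gt0 | exists k].
    move=> [[x y] n] [/= [hx hy] kn]; apply: (hk n kn).
    rewrite /p0 slice_ptB; apply: le_trans (slice_pt_norm_le _ _ IS) _.
    move: hx hy; rewrite -!ball_normE /= => /ltW hx /ltW hy.
    by rewrite [ep]splitr lerD.
  have [p0r|rp0] := leP `|p0| r; last first.
    exists ((`|p0| - r) / 2); first by rewrite divr_gt0 // subr_gt0.
    exists 0%N => k _ x y h L _ /= pr; exfalso.
    have := ler_distD (slice_pt I x y) p0 0; rewrite !subr0 => h'.
    lra.
  have p01 : `|p0| < 1 by apply: le_lt_trans r1.
  set c := `|qsum e p0|; have c0 : 0 < c by rewrite normr_gt0; apply: nz.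
  (* Of [c], one quarter is lost to convergence at [p0] and one quarter to the Lipschitz bound
     towards the nearby point; half remains. C + 1 keeps the divisor positive. *)
  exists (c / 4 * r / (C + 1)); first by rewrite !mulr_gt0 ?invr_gt0 ?ltr_wpDl.
  have /cvgrPdist_lt /(_ (c / 4)) [|k1 _ hk1] := cvg_psum es p01; first by rewrite divr_gt0.
  have [k2 hk2] : exists k2, forall k, (k2 <= k)%N -> k.+1%:R^-1 <= c / 2.
    exists (Num.truncn (2 / c)) => k hk; rewrite -[leRHS]invrK lef_pV2 ?posrE ?invr_gt0 ?divr_gt0 //.
    rewrite invf_div; apply: le_trans (ltW (truncnS_gt _)) _.
    by rewrite ler_nat.
  exists (maxn k1 k2) => k; rewrite geq_max => /andP[kk1 kk2] x y h L kL /= pr.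
  apply: le_trans (hk2 _ kk2) _.
  have h1 := hk1 L (leq_trans kk1 kL); rewrite /= in h1.
  have h2 := psum_lipschitz L p0r pr hC.
  have h3 : `|psum e p0 L - psum e (slice_pt I x y) L| <= c / 4.
    rewrite -(ler_pM2l r0); apply: le_trans h2 _.
    apply: (@le_trans _ _ ((C + 1) * (c / 4 * r / (C + 1)))).
      by apply: ler_pM => //; rewrite lerDl.
    by rewrite mulrC mulfVK ?[r * _]mulrC // gt_eqF // ltr_wpDl.
  have := ler_normD (qsum e p0 - psum e p0 L) (psum e p0 L - psum e (slice_pt I x y) L).
  rewrite addrA subrK => h4.
  have := ler_normD (qsum e p0 - psum e (slice_pt I x y) L) (psum e (slice_pt I x y) L).
  rewrite subrK -/c => h5; lra.
move/compact_near_coveringP: cpt => /(_ nat \oo P _ (fun xy _ => nearP xy)) [k _ hk].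
 exists k => L kL x y pr; apply: (hk k (leqnn k) (x, y) _ L kL pr).
have pr2 : x ^+ 2 + y ^+ 2 <= r ^+ 2.
  by rewrite -(slice_pt_norm _ _ IS); apply: lerXn2r; rewrite ?nnegrE // ltW.
split; rewrite /= in_itv /= -ler_norml -(ler_pXn2r (ltn0Sn 1)) ?nnegrE ?(ltW r0) //.
  by rewrite real_normK ?num_real //; have := sqr_ge0 y; lra.
by rewrite real_normK ?num_real //; have := sqr_ge0 x; lra.
Qed.

End LowerBound.

(** * Regular quotients *)

Section HarnackQuotient.
Variable R : realType.
Local Notation H := (quat R).
Implicit Types (e d c : nat -> H) (p q I : H) (x y r s t : R) (nu de : nat -> R).

Lemma pow_summable_inverse nu de : nu 0%N = 1 -> pow_summable (alg_seq nu) ->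
  (forall p, `|p| < 1 -> qsum (alg_seq nu) p != 0) ->
  cauchy_prod nu de = @cauchy_one R -> pow_summable (alg_seq de).
Proof.
move=> nu0 nus nz inv; apply: pow_summable_bounded => t t0 t1.
have [r0 r1 tr] := mid_radius (ltW t0) t1; set r := (t + 1) / 2 in r0 r1 tr.
pose I : H := slice_unit 0; have IS : imag_sphere I by exact: slice_unit_sphere.
have [k hk] := psum_lower_bound nus IS r0 r1 (fun x y => nz (slice_pt I x y)).
(* [L] is at least [k] for the lower bound, and exceeds [n] so that the truncation has the same n-th
   inverse coefficient. The bound itself involves only [k]. *)
exists (2 / k.+1%:R^-1) => n; pose L := (k + n.+1)%N.
have tr0 : trunc_seq L nu 0%N = 1 by rewrite /trunc_seq /L addnS.
have [w winv] := formal_inverse tr0.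
have L0 : (0 < L)%N by rewrite /L addnS.
have kL : (k <= L)%N by apply: leq_addr.
have k0 : (0 : R) < k.+1%:R^-1 by rewrite invr_gt0.
have := inverse_bound IS nu0 L0 t0 tr k0 (hk L kL) winv n.
have -> // : w n = de n.
  apply: (formal_inverse_unique (L := L) tr0 nu0) (n) _ => [m mL|m mL|].
  - by rewrite /trunc_seq mL.
  - by rewrite winv inv.
  - exact: leq_addl.
by rewrite /alg_seq quat_norm_alg.
Qed.

Lemma left_quotient e d : pow_summable e -> pow_summable d -> e 0%N = 1 -> d 0%N = 1 ->
  (forall q, `|q| < 1 -> qsum e q != 0) ->
  exists c, [/\ pow_summable c, cauchy_prod e c = d, c 0%N = 1 & c 1%N = d 1%N - e 1%N].
Proof.
move=> es ds e0 d0 nz; pose nu n := quat_re (norm_seq e n).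
have nuE : norm_seq e = alg_seq nu by apply/funext => n; rewrite /alg_seq -norm_seq_real.
have nu0 : nu 0%N = 1.
  by rewrite /nu /norm_seq cauchy_prod0n e0 quat_mul_conj quat_norm1 expr1n /= mulr1.
have [de inv] := formal_inverse nu0.
have des : pow_summable (alg_seq de).
  apply: (pow_summable_inverse nu0) => //; rewrite -nuE; first exact: pow_summable_norm_seq.
  by move=> p; apply: norm_seq_neq0.
(* Conjugate series, inverse symmetrization, then [d]: multiplication by [e] on the left cancels the
   first two factors. *)
pose c := cauchy_prod (fun n => quat_conj (e n)) (cauchy_prod (alg_seq de) d).
have ec : cauchy_prod e c = d.
  rewrite /c cauchy_prodA -/(norm_seq e) nuE cauchy_prodA alg_seq_cauchy_prod inv.
  have -> : alg_seq (@cauchy_one R) = @cauchy_one H.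
    by apply/funext => n; rewrite /alg_seq /cauchy_one; case: (n == 0%N); rewrite ?scale1r ?scale0r.
  exact: cauchy_prod1.
have c0 : c 0%N = 1 by have := cauchy_prod0n e c; rewrite ec e0 d0 mul1r.
exists c; split => //.
  apply: pow_summable_cauchy_prod; first exact: pow_summable_quat_conj.
  exact: pow_summable_cauchy_prod.
by rewrite -ec cauchy_prod1n e0 c0 mul1r mulr1 addrK.
Qed.

Lemma polar_decomposition p : exists I th,
  imag_sphere I /\ p = slice_pt I (`|p| * cos th) (`|p| * sin th).
Proof.
have IS := slice_unit_sphere p; exists (slice_unit p).
have [p0|p0] := eqVneq p 0.
  by exists 0; split => //; rewrite p0 normr0 !mul0r /slice_pt !scale0r addr0.
have np : 0 < `|p| by rewrite normr_gt0.
set x := quat_re p; set y := `|quat_im p|.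
have n2 : `|p| ^+ 2 = x ^+ 2 + y ^+ 2 by rewrite -(slice_pt_norm x y IS) slice_ptE.
pose a := x / `|p|.
have a2 : a ^+ 2 <= 1.
  by rewrite /a expr_div_n ler_pdivrMr ?exprn_gt0 // mul1r n2 lerDl sqr_ge0.
have a1 : -1 <= a <= 1 by rewrite -ler_norml -(ler_pXn2r (ltn0Sn 1)) ?nnegrE // real_normK ?num_real // expr1n.
exists (acos a); split => //.
have -> : `|p| * cos (acos a) = x by rewrite acosK // /a mulrC divfK // gt_eqF.
have -> : `|p| * sin (acos a) = y.
  rewrite sin_acos //; apply: (@pexpIrn _ 2); rewrite ?nnegrE ?mulr_ge0 ?sqrtr_ge0 //.
  have sq : Num.sqrt (1 - a ^+ 2) ^+ 2 = 1 - a ^+ 2 by rewrite sqr_sqrtr ?subr_ge0.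
  rewrite exprMn sq /a mulrBr mulr1 expr_div_n [_ * (_ / _)]mulrC.
  by rewrite divfK ?expf_neq0 ?gt_eqF // n2 addrC addKr.
by rewrite slice_ptE.
Qed.

Lemma harnack_radius c I th r s : pow_summable c -> imag_sphere I -> c 0%N = 1 ->
  (forall p, `|p| < 1 -> 0 <= quat_re (qsum c p)) -> 0 < r -> r < s -> s < 1 ->
  (1 - s ^+ 2) / (1 + s ^+ 2 + s * `|c 1%N|)
    <= quat_re (qsum c (slice_pt I (r * cos th) (r * sin th))).
Proof.
move=> cs IS c0 pos r0 rs s1.
have s0 : 0 < s by apply: lt_trans rs.
(* The series is sampled on the circle of radius [rho] below 1; the Poisson parameter [s] then
   reaches radius s rho = r. *)
pose rho := r / s; have rho0 : 0 < rho by rewrite divr_gt0.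
have rho1 : rho < 1 by rewrite ltr_pdivrMr // mul1r.
have [t0 t1 rt] := mid_radius (ltW rho0) rho1; set t := (rho + 1) / 2 in t0 t1 rt.
have [C hC] := cs t t0 t1; have C0 : 0 <= C by have := hC 0%N; rewrite big_ord0.
pose x := rho / t; have x0 : 0 <= x by rewrite divr_ge0 // ltW.
have x1 : x < 1 by rewrite ltr_pdivrMr // mul1r.
pose A n := rho ^+ n * quat_re (c n); pose B n := rho ^+ n * quat_re (I * c n).
pose pt u v : H := slice_pt I (u * cos v) (u * sin v).
have ptn u v : 0 < u -> `|pt u v| = u by move=> u0; apply: slice_pt_polar_norm => //; apply: ltW.
have rrho : r < rho by rewrite /rho ltr_pdivlMr // gtr_pMr.
have A0 : A 0%N = 1 by rewrite /A expr0 mul1r c0.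
have W1 : - `|c 1%N| <= A 1%N * cos th + B 1%N * sin th.
  have -> : A 1%N * cos th + B 1%N * sin th = quat_re (pt rho th * c 1%N).
    by rewrite re_slice_ptM /A /B !expr1; ring.
  have := quat_re_norm (pt rho th * c 1%N); rewrite quat_normM ptn // ler_norml => /andP[+ _].
  by apply: le_trans; rewrite lerN2 ler_piMl // ltW.
have tail u v K : 0 < u -> u <= rho -> `|qsum c (pt u v) - psum c (pt u v) K| <= C * x ^+ K.
  move=> u0 ur; have ut : u <= t by apply: le_trans ur (ltW rt).
  apply: le_trans (qsum_dist K cs t0 t1 _ hC) _; rewrite ptn //.
  have ut0 : 0 <= u / t by apply: divr_ge0; apply: ltW.
  rewrite ler_wpM2l //; apply: lerXn2r; rewrite ?nnegrE //.
  by rewrite /x ler_pM2r ?invr_gt0.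
(* Two tails of size C x^(L+2), one for positivity at radius [rho] and one for the value at radius
   [r], plus the kernel error with its [del] replaced by the bound [C]. *)
pose v L := (2 * C * x ^+ 2) * x ^+ L + ((1 + C) * (4 * s ^+ 2 / (1 - s) ^+ 2)) * s ^+ L.
have v0 : v @ \oo --> (0 : R).
  rewrite -[0]addr0; apply: cvgD; apply: cvg_geometric_mul => //; exact: ltW.
apply: (ler_of_cvg0 v0); exists 0%N => // L _ /=.
pose del := C * x ^+ L.+2; have del0 : 0 <= del by rewrite mulr_ge0 ?exprn_ge0.
have Ud y : - del <= trig A B L.+2 y.
  rewrite -(psum_polar_re IS).
  have := tail rho y L.+2 rho0 (lexx _); rewrite -/del -/(pt rho y) => h.
  have := le_trans (quat_re_norm _) h; rewrite quat_reB ler_norml => /andP[_ h'].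
  have := pos (pt rho y); rewrite ptn // => /(_ rho1); lra.
have := trig_harnack s0 s1 (normr_ge0 (c 1%N)) A0 W1 del0 Ud.
rewrite (_ : trig _ _ _ _ = quat_re (psum c (pt r th) L.+2)); last first.
  have rE : r = s * rho by rewrite /rho mulrC divfK // gt_eqF.
  have rn n : r ^+ n = s ^+ n * rho ^+ n by rewrite -exprMn -rE.
  by rewrite (psum_polar_re IS); apply: eq_bigr => n _; rewrite /A /B rn; ring.
move=> h; apply: le_trans h _.
have := tail r th L.+2 r0 (ltW rrho); rewrite -/del distrC => h1.
have := le_trans (quat_re_norm _) h1; rewrite quat_reB ler_norml => /andP[_ h2].
have delC : del <= C by rewrite /del ler_piMr // exprn_ile1 // ltW.
have e0 : 0 <= 4 * s ^+ L.+2 / (1 - s) ^+ 2.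
  by apply: divr_ge0; rewrite ?exprn_ge0 ?subr_ge0 ?(ltW s1) // mulr_ge0 ?exprn_ge0 ?(ltW s0).
have -> : v L = del + del + (1 + C) * (4 * s ^+ L.+2 / (1 - s) ^+ 2).
  have xL : x ^+ L.+2 = x ^+ 2 * x ^+ L by rewrite -exprD.
  have sL : s ^+ L.+2 = s ^+ 2 * s ^+ L by rewrite -exprD.
  by rewrite /v /del xL sL; ring.
have : (1 + del) * (4 * s ^+ L.+2 / (1 - s) ^+ 2) <= (1 + C) * (4 * s ^+ L.+2 / (1 - s) ^+ 2).
  by rewrite ler_wpM2r // lerD2l.
move: h2; rewrite -/(pt r th); move: (_ / (1 - s) ^+ 2) (quat_re _) (quat_re _) => E u w h2 hE; lra.
Qed.

Lemma caratheodory_re_ge c p : pow_summable c -> c 0%N = 1 ->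
  (forall p, `|p| < 1 -> 0 <= quat_re (qsum c p)) -> `|p| < 1 ->
  (1 - `|p| ^+ 2) / (1 + `|c 1%N| * `|p| + `|p| ^+ 2) <= quat_re (qsum c p).
Proof.
move=> cs c0 pos p1; have [->|p0] := eqVneq p 0.
  by rewrite normr0 mulr0 expr0n /= subr0 !addr0 qsum0 c0 divr1.
set r := `|p| in p1 *; have r0 : 0 < r by rewrite normr_gt0.
set G := quat_re _; set b := `|c 1%N|; have b0 : 0 <= b by exact: normr_ge0.
have G0 : 0 <= G by apply: pos.
have [I [th [IS pE]]] := polar_decomposition p.
have hs s : r < s -> s < 1 -> 1 - s ^+ 2 <= G * (1 + s ^+ 2 + s * b).
  move=> rs s1; have := harnack_radius th cs IS c0 pos r0 rs s1; rewrite -/b -pE -/G.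
  have s0 : 0 < s by apply: lt_trans rs.
  rewrite ler_pdivrMr //; have := sqr_ge0 s; have := mulr_ge0 (ltW s0) b0; lra.
have X0 : 0 < 1 + b * r + r ^+ 2.
  have := sqr_ge0 r; have := mulr_ge0 b0 (ltW r0); lra.
rewrite ler_pdivrMr //; apply/ler_addgt0Pr => eps eps0.
(* [M] bounds the cost, per unit of [h], of replacing s = r + h by r in [hs], using 2 r + h <= 2. *)
pose M := G * (2 + b) + 2; have M0 : 0 < M.
  by rewrite /M; have := mulr_ge0 G0 b0; lra.
pose h := Num.min (eps / M) ((1 - r) / 2).
have h0 : 0 < h by rewrite /h lt_min !divr_gt0 ?subr_gt0.
have hM : h * M <= eps by rewrite -ler_pdivlMr // /h ge_min lexx.
have h1 : h <= (1 - r) / 2 by rewrite /h ge_min lexx orbT.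
have := hs (r + h); rewrite ltrDl => /(_ h0) hs'.
have := hs' _; have -> : r + h < 1 by lra. move=> /(_ isT) {}hs'.
have Gb := mulr_ge0 G0 b0.
have Gh := mulr_ge0 G0 (ltW h0).
have e1 : h * (r + r + h) <= h * 2 by rewrite ler_pM2l //; lra.
have e2 : G * (h * (r + r + h)) <= G * (h * 2) by rewrite ler_wpM2l.
rewrite /M in hM; nra.
Qed.

(** Stated for an arbitrary pair of series because it is applied with [e] and [d] in either
    order. *)
Lemma re_quotient_ge e d q : pow_summable e -> pow_summable d ->
  e 0%N = 1 -> d 0%N = 1 -> (forall p, `|p| < 1 -> qsum e p != 0) ->
  (forall p, `|p| < 1 -> 0 <= quat_re ((qsum e p)^-1 * qsum d p)) -> `|q| < 1 ->
  (1 - `|q| ^+ 2) / (1 + `|d 1%N - e 1%N| * `|q| + `|q| ^+ 2)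
    <= quat_re ((qsum e q)^-1 * qsum d q).
Proof.
move=> es ds e0 d0 nz pos q1.
have [c [cs ec c0 c1]] := left_quotient es ds e0 d0 nz.
have cE p : `|p| < 1 ->
    qsum c ((qsum e p)^-1 * p * qsum e p) = (qsum e p)^-1 * qsum d p.
  by move=> p1; rewrite -ec; apply: qsum_cauchy_prod_conj => //; apply: nz.
have posc p : `|p| < 1 -> 0 <= quat_re (qsum c p).
  move=> p1; have [p' p'p <-] := qsum_conj_surj es nz p1.
  have p'1 : `|p'| < 1 by rewrite p'p.
  by rewrite cE //; apply: pos.
rewrite -cE // -c1 -(conjV_norm q (nz q q1)); apply: caratheodory_re_ge => //.
by rewrite conjV_norm //; apply: nz.
Qed.

End HarnackQuotient.

(** * Differentiation *)

Section Derivative.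
Variable R : realType.
Local Notation H := (quat R).
Implicit Types (e : nat -> H) (p q h v : H) (x y r s t C : R) (n N : nat).

(** Power series are differentiated along real lines through second-order remainder bounds of this
    form. *)
Lemma is_derive_quadratic (V : normedModType R) (g : R -> V) x (l : V) C del :
  0 < del -> (forall u, `|u| < del -> `|g (u + x) - g x - u *: l| <= C * u ^+ 2) ->
  is_derive x (1 : R) g l.
Proof.
move=> del0 hC.
suff cv : (fun u : R => u^-1 *: (g (u *: (1 : R) + x) - g x)) @ (0 : R)^' --> l.
  by apply: DeriveDef; [apply/cvg_ex; exists l | apply: cvg_lim].
have C1 : 0 < `|C| + 1 by rewrite ltr_wpDl.
apply/cvgrPdist_lt => ep ep0.
near=> u.
have u0 : u != 0 by near: u; exact: nbhs_dnbhs_neq.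
have udel : `|u| < Num.min del (ep / (`|C| + 1)).
  near: u; apply: nbhs_dnbhs; exists (Num.min del (ep / (`|C| + 1))) => /=.
    by rewrite lt_min del0 divr_gt0.
  by move=> z /=; rewrite sub0r normrN.
move: udel; rewrite lt_min => /andP[ud ue].
have -> : u *: (1 : R) = u by rewrite [LHS]mulr1.
have -> : l - u^-1 *: (g (u + x) - g x) = - (u^-1 *: (g (u + x) - g x - u *: l)).
  by rewrite [in RHS]scalerBr scalerA mulVf // scale1r opprB.
rewrite normrN normrZ normfV; have nu : 0 < `|u| by rewrite normr_gt0.
rewrite mulrC ltr_pdivrMr //; apply: le_lt_trans (hC u ud) _.
rewrite -[u ^+ 2]real_normK ?num_real // expr2 mulrA ltr_pM2r //.
apply: (@le_lt_trans _ _ ((`|C| + 1) * `|u|)).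
  by rewrite ler_pM2r //; apply: le_trans (ler_norm _) _; rewrite lerDl.
by rewrite mulrC -ltr_pdivlMr.
Unshelve. all: by end_near. Qed.

Definition dcoef e n : H := n.+1%:R *: e n.+1.

Lemma pow_summable_dcoef e : pow_summable e -> pow_summable (dcoef e).
Proof.
by move=> es; apply: (pow_summableS (e := fun n => n%:R *: e n)); apply: pow_summableZn.
Qed.

Lemma psum_dcoef e p N :
  psum (dcoef e) p N = \sum_(n < N.+1) n%:R *: (p ^+ n.-1 * e n).
Proof.
rewrite big_ord_recl /= scale0r add0r; apply: eq_bigr => n _.
by rewrite /dcoef -scalerAr.
Qed.

(** The remainder obeys D_(n+1) = (p + h) D_n + n h^2 p^(n-1), and n^2 + n <= (n+1)^2 closes the
    induction. The factor t^2 on the left avoids the exponent n - 2; at n = 0 the predecessor is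
    harmless since its coefficient is 0. *)
Lemma expr_taylor p h t n : `|p| <= t -> `|p + h| <= t -> p * h = h * p ->
  t ^+ 2 * `|(p + h) ^+ n - p ^+ n - n%:R *: (h * p ^+ n.-1)|
    <= n%:R ^+ 2 * t ^+ n * `|h| ^+ 2.
Proof.
move=> pt pht ph; have t0 : 0 <= t by apply: le_trans pt.
elim: n => [|n IH]; first by rewrite !expr0 subrr scale0r subr0 normr0 mulr0 expr0n /= !mul0r.
pose D := (p + h) ^+ n - p ^+ n - n%:R *: (h * p ^+ n.-1).
have -> : (p + h) ^+ n.+1 - p ^+ n.+1 - n.+1%:R *: (h * p ^+ n.+1.-1)
    = (p + h) * D + n%:R *: (h * h * p ^+ n.-1).
  have hpn k : h * p ^+ k = p ^+ k * h.
    by elim: k => [|k IHk]; rewrite ?expr0 ?mul1r ?mulr1 // exprS mulrA -ph -mulrA IHk mulrA.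
  have pn1 : n%:R *: (p * (h * p ^+ n.-1)) = n%:R *: (h * p ^+ n).
    case: (n) => [|m]; first by rewrite !scale0r.
    by rewrite /= mulrA ph -mulrA -exprS.
  rewrite /D mulrBr mulrBr -exprS -scalerAr [(p + h) * (h * _)]mulrDl scalerDr pn1.
  rewrite [(p + h) * p ^+ n]mulrDl -exprS -natr1 scalerDl scale1r /=.
  by rewrite mulrA; apply: quatP => /=; ring.
apply: le_trans (ler_wpM2l (sqr_ge0 t) (ler_normD _ _)) _.
rewrite quat_normM normrZ normr_nat !quat_normM quat_normX mulrDr.
apply: (@le_trans _ _ (t * (n%:R ^+ 2 * t ^+ n * `|h| ^+ 2) + n%:R * t ^+ n.+1 * `|h| ^+ 2)).
  apply: lerD.
    apply: (@le_trans _ _ (t * (t ^+ 2 * `|D|))).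
      by rewrite [leRHS]mulrCA ler_wpM2l ?sqr_ge0 // ler_wpM2r.
    by rewrite ler_wpM2l.
  case: n {IH D} => [|m]; first by rewrite !mul0r mulr0.
  rewrite /= [leLHS](_ : _ = m.+1%:R * (t ^+ 2 * `|p| ^+ m) * `|h| ^+ 2); last by ring.
  have -> : t ^+ m.+2 = t ^+ 2 * t ^+ m by rewrite -exprD.
  rewrite ler_wpM2r ?sqr_ge0 // ler_wpM2l // ler_wpM2l ?sqr_ge0 //.
  by apply: lerXn2r; rewrite ?nnegrE.
rewrite [t ^+ n.+1]exprS -natr1.
have X0 : 0 <= t * t ^+ n * `|h| ^+ 2 by rewrite !mulr_ge0 ?exprn_ge0.
rewrite -subr_ge0.
rewrite (_ : _ - _ = n%:R * (t * t ^+ n * `|h| ^+ 2) + t * t ^+ n * `|h| ^+ 2); last by ring.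
by rewrite addr_ge0 // mulr_ge0.
Qed.

Lemma qsum_taylor e p h t C : pow_summable e -> t < 1 -> 0 < t ->
  `|p| <= t -> `|p + h| <= t -> p * h = h * p ->
  (forall M, \sum_(n < M) `|n%:R *: (n%:R *: e n)| * t ^+ n <= C) ->
  `|qsum e (p + h) - qsum e p - h * qsum (dcoef e) p| <= C / t ^+ 2 * `|h| ^+ 2.
Proof.
move=> es t1 t0 pt pht ph hC.
have p1 : `|p| < 1 by apply: le_lt_trans t1.
have ph1 : `|p + h| < 1 by apply: le_lt_trans t1.
(* The shift matches lengths: [N] terms of the derived series come from [N.+1] terms of the
   original. *)
pose u N := psum e (p + h) N.+1 - psum e p N.+1 - h * psum (dcoef e) p N * 1.
have uc : u @ \oo --> qsum e (p + h) - qsum e p - h * qsum (dcoef e) p * 1.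
  have sh q : `|q| < 1 -> (fun N => psum e q N.+1) @ \oo --> qsum e q.
    by move=> q1; rewrite (cvg_shiftS (psum e q)); apply: cvg_psum.
  have ds := cvg_psum (pow_summable_dcoef es) p1.
  exact: (cvgB (cvgB (sh _ ph1) (sh _ p1)) (cvgn_quatM ds)).
rewrite mulr1 in uc; rewrite -[X in `|X|]subr0; apply: (lim_norm_le (K := 0) uc) => N _.
rewrite subr0 /u mulr1 psum_dcoef /psum -sumrB mulr_sumr -sumrB.
apply: le_trans (ler_norm_sum _ _ _) _.
rewrite mulrAC ler_pdivlMr ?exprn_gt0 //.
apply: le_trans (_ : _ <= (\sum_(n < N.+1) `|n%:R *: (n%:R *: e n)| * t ^+ n) * `|h| ^+ 2) _;
  last by rewrite ler_wpM2r ?sqr_ge0.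
rewrite !mulr_suml; apply: ler_sum => n _.
have -> : (p + h) ^+ n * e n - p ^+ n * e n - h * (n%:R *: (p ^+ n.-1 * e n))
    = ((p + h) ^+ n - p ^+ n - n%:R *: (h * p ^+ n.-1)) * e n.
  by rewrite !mulrBl -scalerAl -scalerAr mulrA.
rewrite quat_normM.
have := expr_taylor n pt pht ph; rewrite !normrZ normr_nat.
move/(ler_wpM2r (normr_ge0 (e n))) => h1.
apply: le_trans (_ : _ <= n%:R ^+ 2 * t ^+ n * `|h| ^+ 2 * `|e n|) _.
  by apply: le_trans h1; rewrite mulrC mulrA.
by rewrite le_eqVlt; apply/orP; left; apply/eqP; ring.
Qed.

(* [v] commutes with [p], so that [p + u v] stays in one slice. *)
Lemma qsum_dir_quadratic e p v : pow_summable e -> `|p| < 1 -> `|v| <= 1 -> p * v = v * p ->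
  exists C del, 0 < del /\ forall u : R, `|u| < del ->
    `|qsum e (p + u *: v) - qsum e p - u *: (v * qsum (dcoef e) p)| <= C * u ^+ 2.
Proof.
move=> es p1 v1 pv; have [t0 t1 pt] := mid_radius (normr_ge0 p) p1.
set t := (`|p| + 1) / 2 in t0 t1 pt.
have [C hC] := pow_summableZn (pow_summableZn es) t0 t1.
have C0 : 0 <= C by have := hC 0%N; rewrite big_ord0.
exists (C / t ^+ 2), (t - `|p|); split; first by rewrite subr_gt0.
move=> u ut; rewrite scalerAl.
have uv : `|u *: v| <= `|u| by rewrite normrZ ler_piMr.
have put : `|p + u *: v| <= t.
  by apply: le_trans (ler_normD _ _) _; move: uv ut; lra.
apply: le_trans (qsum_taylor es t1 t0 (ltW pt) put _ hC) _.
  by rewrite -scalerAr -scalerAl pv.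
rewrite ler_wpM2l ?divr_ge0 ?sqr_ge0 // -[leRHS]real_normK ?num_real //.
by apply: lerXn2r; rewrite ?nnegrE.
Qed.

End Derivative.

(** * Growth along rays *)

Section Growth.
Variable R : realType.
Local Notation H := (quat R).
Implicit Types (e d : nat -> H) (p q u : H) (b r s t C : R).

Lemma is_derive_ln_comp (g : R -> R) t (dg : R) : 0 < g t ->
  is_derive t (1 : R) g dg -> is_derive t (1 : R) (fun s => ln (g s)) (dg / g t).
Proof.
move=> g0 [dgt gE]; have [dl lE] := is_derive1_ln g0.
apply: DeriveDef.
  apply/derivable1_diffP; apply: (@differentiable_comp _ _ _ _ g (@ln R)).
    exact/derivable1_diffP.
  exact/derivable1_diffP.
rewrite -derive1E (@derive1_comp _ g (@ln R)) // !derive1E gE lE.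
exact: mulrC.
Qed.

Lemma is_derive_quadratic_poly b c t :
  is_derive t (1 : R) (fun s => 1 + b * s + c * s ^+ 2) (b + c * (2 * t)).
Proof.
apply: (@is_derive_quadratic R _ _ _ _ `|c| 1) => // s _.
have -> : 1 + b * (s + t) + c * (s + t) ^+ 2 - (1 + b * t + c * t ^+ 2) - s *: (b + c * (2 * t))
   = c * s ^+ 2 by rewrite /GRing.scale /=; ring.
by rewrite normrM [`|s ^+ 2|]ger0_norm // sqr_ge0.
Qed.

(** The sign is asked for at t > 0 because the formula for the logarithmic derivative divides by
    [t]. *)
Lemma mono_of_derive (g g' : R -> R) r : 0 <= r ->
  (forall t, 0 <= t <= r -> is_derive t (1 : R) g (g' t)) ->
  (forall t, 0 < t <= r -> 0 <= g' t) -> g 0 <= g r.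
Proof.
rewrite le_eqVlt => /orP[/eqP <- //|r0] gd g'0.
have gd' t : t \in `]0, r[ -> is_derive t (1 : R) g (g' t).
  by rewrite in_itv /= => /andP[t0 tr]; apply: gd; rewrite !ltW.
have gc : {within `[0, r], continuous g}.
  apply: derivable_within_continuous => t; rewrite in_itv /= => /gd h.
  exact: ex_derive.
have [t + h] := MVT r0 gd' gc; rewrite in_itv /= => /andP[t0 tr].
by rewrite -subr_ge0 h subr0 mulr_ge0 ?(ltW r0) // g'0 // t0 ltW.
Qed.

Lemma quat_norm_sqrD p q :
  `|p + q| ^+ 2 = `|p| ^+ 2 + 2 * quat_re (quat_conj p * q) + `|q| ^+ 2.
Proof.
rewrite !quat_norm_sqr /quat_sqnorm.
by case: p q => [? ? ? ?] [? ? ? ?] /=; ring.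
Qed.

Lemma is_derive_qsum_sqnorm e u t : pow_summable e -> `|u| = 1 -> `|t| < 1 ->
  is_derive t (1 : R) (fun s => `|qsum e (s *: u)| ^+ 2)
    (2 * quat_re (quat_conj (qsum e (t *: u)) * (u * qsum (dcoef e) (t *: u)))).
Proof.
move=> es u1 t1; have q1 : `|t *: u| < 1 by rewrite normrZ u1 mulr1.
have cu : (t *: u) * u = u * (t *: u) by rewrite -scalerAl -scalerAr.
have ule : `|u| <= 1 by rewrite u1.
have [C [del [del0 hC]]] := qsum_dir_quadratic es q1 ule cu.
set ph := qsum e (t *: u) in hC *; set w := u * _ in hC *.
apply: (@is_derive_quadratic R _ _ _ _ (2 * `|ph| * `|C| + (`|w| + `|C|) ^+ 2)
   (Num.min del 1)) => [|s]; first by rewrite lt_min del0 ltr01.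
rewrite lt_min => /andP[sdel s1].
have -> : (s + t) *: u = t *: u + s *: u by rewrite addrC scalerDl.
set ps := qsum e _; pose D := ps - ph; pose rho := D - s *: w.
have Drho : D = s *: w + rho by rewrite /rho addrC subrK.
have rhoC : `|rho| <= `|C| * s ^+ 2.
  by apply: le_trans (hC s sdel) _; rewrite ler_wpM2r ?sqr_ge0 // ler_norm.
have s2 : s ^+ 2 = `|s| * `|s| by rewrite -expr2 real_normK ?num_real.
(* The radius was capped at 1 for this step: |s| < 1 turns the quadratic remainder into a linear
   one. *)
have DC : `|D| <= `|s| * (`|w| + `|C|).
  rewrite Drho mulrDr; apply: le_trans (ler_normD _ _) _; rewrite normrZ lerD2l.
  apply: le_trans rhoC _; rewrite s2 mulrC -mulrA ler_wpM2l // ler_piMl // ltW //.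
have psE : ps = ph + D by rewrite /D addrC subrK.
rewrite psE quat_norm_sqrD.
have -> : `|ph| ^+ 2 + 2 * quat_re (quat_conj ph * D) + `|D| ^+ 2 - `|ph| ^+ 2
    - s *: (2 * quat_re (quat_conj ph * w)) = 2 * quat_re (quat_conj ph * rho) + `|D| ^+ 2.
  have -> : quat_conj ph * D = s *: (quat_conj ph * w) + quat_conj ph * rho.
    by rewrite Drho mulrDr -scalerAr.
  rewrite quat_reD quat_reZ /GRing.scale /=; ring.
apply: le_trans (ler_normD _ _) _; rewrite [leRHS]mulrDl; apply: lerD.
  rewrite normrM (ger0_norm (_ : 0 <= 2)) // -!mulrA ler_wpM2l //.
  apply: le_trans (quat_re_norm _) _; rewrite quat_normM quat_conj_norm.
  by rewrite ler_wpM2l.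
rewrite ger0_norm ?sqr_ge0 // mulrC s2 -expr2 -exprMn.
by apply: lerXn2r; rewrite ?nnegrE // mulr_ge0 // addr_ge0.
Qed.

Lemma unit_direction q : exists2 u : H, `|u| = 1 & q = `|q| *: u.
Proof.
have [->|q0] := eqVneq q 0; first by exists 1; rewrite ?quat_norm1 // normr0 scale0r.
have nq : `|q| != 0 by rewrite normr_eq0.
exists (`|q|^-1 *: q); first by rewrite normrZ normfV normr_id mulVf.
by rewrite scalerA mulfV // scale1r.
Qed.

Lemma qsum_shift e q : pow_summable e -> `|q| < 1 ->
  qsum (fun n => if n is m.+1 then e m else 0) q = q * qsum e q.
Proof.
move=> es q1; apply: qsum_unique; rewrite -(cvg_shiftS (psum _ q)).
have h := cvgn_quatM (x := q) (y := 1) (cvg_psum es q1).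
rewrite mulr1 in h; apply: cvg_trans h; apply: near_eq_cvg; apply: nearW => N.
rewrite /= /psum big_ord_recl mulr0 add0r mulr1 mulr_sumr; apply: eq_bigr => n _.
by rewrite /= exprS mulrA.
Qed.

Lemma pow_summable_scaled e : pow_summable e -> pow_summable (fun n => n.+1%:R *: e n).
Proof.
move=> es t t0 t1; have [C1 h1] := es t t0 t1; have [C2 h2] := pow_summableZn es t0 t1.
exists (C1 + C2) => N; apply: le_trans (lerD (h1 N) (h2 N)).
rewrite -big_split; apply: ler_sum => n _ /=; rewrite -mulrDl ler_wpM2r ?exprn_ge0 ?(ltW t0) //.
by rewrite -natr1 scalerDl scale1r addrC ler_normD.
Qed.

Lemma qsum_scaled e q : pow_summable e -> `|q| < 1 ->
  qsum (fun n => n.+1%:R *: e n) q = qsum e q + q * qsum (dcoef e) q.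
Proof.
move=> es q1; apply: qsum_unique.
have ds := pow_summable_dcoef es.
pose g n : H := if n is m.+1 then dcoef e m else 0.
have gs : pow_summable g.
  apply: pow_summable_le (pow_summableZn es) _ => -[|n] /=; first by rewrite normr0.
  by [].
rewrite -(qsum_shift ds q1) -/g.
have h : (fun N => psum e q N + psum g q N) @ \oo --> qsum e q + qsum g q.
  exact: cvgD (cvg_psum es q1) (cvg_psum gs q1).
apply: cvg_trans h; apply: near_eq_cvg; apply: nearW => N.
rewrite /= /psum -big_split; apply: eq_bigr => -[[|n] nN] _ /=.
  by rewrite scale1r mulr0 addr0.
by rewrite -natr1 scalerDl scale1r addrC mulrDr.
Qed.

End Growth.

(** * Bounds on the quotient E^-1 D and on the growth of E *)

Section StarlikeGrowth.
Variable R : realType.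
Local Notation H := (quat R).
Variable e : nat -> H.
(** Coefficients of f' when f = qE. *)
Let d n : H := n.+1%:R *: e n.
Let b := `|e 1%N|.
Hypotheses (es : pow_summable e) (e0 : e 0%N = 1).
Hypothesis nz : forall q, `|q| < 1 -> qsum e q != 0.
Hypothesis pos : forall q, `|q| < 1 -> 0 < quat_re ((qsum e q)^-1 * qsum d q).
Implicit Types (q u : H) (r s t : R).

Let b0 : 0 <= b. Proof. exact: normr_ge0. Qed.

Lemma starlike_re_ge q : `|q| < 1 ->
  (1 - `|q| ^+ 2) / (1 + b * `|q| + `|q| ^+ 2) <= quat_re ((qsum e q)^-1 * qsum d q).
Proof.
move=> q1; have d0 : d 0%N = 1 by rewrite /d scale1r.
have ds : pow_summable d by exact: pow_summable_scaled.
have := re_quotient_ge es ds e0 d0 nz (fun p p1 => ltW (pos p1)) q1.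
have -> // : `|d 1%N - e 1%N| = b.
by rewrite /d -natr1 scalerDl !scale1r addrK.
Qed.

Lemma starlike_derive_neq0 q : `|q| < 1 -> qsum d q != 0.
Proof.
by move=> q1; apply/eqP => D0; have := pos q1; rewrite D0 mulr0 /= ltxx.
Qed.

Lemma starlike_norm_le q : `|q| < 1 ->
  `|(qsum e q)^-1 * qsum d q| <= (1 + b * `|q| + `|q| ^+ 2) / (1 - `|q| ^+ 2).
Proof.
move=> q1; have d0 : d 0%N = 1 by rewrite /d scale1r.
have ds : pow_summable d by exact: pow_summable_scaled.
have VV p : `|p| < 1 -> (qsum d p)^-1 * qsum e p = ((qsum e p)^-1 * qsum d p)^-1.
  by move=> p1; rewrite invrM ?invrK ?unitrV //; [exact: nz | exact: starlike_derive_neq0].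
have neq p : `|p| < 1 -> (qsum e p)^-1 * qsum d p != 0.
  by move=> p1; apply/eqP => h; have := pos p1; rewrite h /= ltxx.
have pos' p : `|p| < 1 -> 0 <= quat_re ((qsum d p)^-1 * qsum e p).
  move=> p1; rewrite VV // quat_re_inv ?neq // divr_ge0 ?sqr_ge0 //.
  exact: ltW (pos p1).
have := re_quotient_ge ds es d0 e0 starlike_derive_neq0 pos' q1.
have -> : `|e 1%N - d 1%N| = b.
  by rewrite distrC /d -natr1 scalerDl !scale1r addrK.
rewrite VV // => h.
have := le_trans h (le_trans (ler_norm _) (quat_re_norm _)); rewrite quat_normV => h'.
have q2 : 0 < 1 - `|q| ^+ 2 by rewrite subr_gt0 expr2 mulr_ilt1.
have X0 : 0 < 1 + b * `|q| + `|q| ^+ 2.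
  have := mulr_ge0 b0 (normr_ge0 q); have := sqr_ge0 `|q|; lra.
rewrite -invf_div -lef_pV2 ?posrE ?invr_gt0 ?divr_gt0 ?normr_gt0 ?neq //.
by rewrite invrK.
Qed.

Let rat u t := quat_re ((qsum e (t *: u))^-1 * qsum d (t *: u)).
Let logder u t := 2 * quat_re (quat_conj (qsum e (t *: u)) * (u * qsum (dcoef e) (t *: u)))
  / `|qsum e (t *: u)| ^+ 2.

Let logderE u t : `|u| = 1 -> 0 < t < 1 -> logder u t = 2 * (rat u t - 1) / t.
Proof.
move=> u1 /andP[t0 t1]; have q1 : `|t *: u| < 1 by rewrite normrZ u1 mulr1 gtr0_norm.
have E0 := nz q1; have n0 : `|qsum e (t *: u)| ^+ 2 != 0 by rewrite expf_neq0 // normr_eq0.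
have tn : t != 0 by rewrite gt_eqF.
have dE : (qsum e (t *: u))^-1 * qsum d (t *: u)
    = 1 + (qsum e (t *: u))^-1 * ((t *: u) * qsum (dcoef e) (t *: u)).
  by rewrite (qsum_scaled es q1) mulrDr mulVr.
rewrite /logder /rat dE quat_reD [quat_re 1]/=.
set E := qsum e _ in E0 n0 *; set E' := qsum (dcoef e) _.
have -> : quat_re (E^-1 * ((t *: u) * E')) = t * quat_re (quat_conj E * (u * E')) / `|E| ^+ 2.
  by rewrite quat_invE // -scalerAl quat_reZ -scalerAl -scalerAr quat_reZ mulrC mulrA.
by field; rewrite normr_eq0 E0 tn.
Qed.

Let is_derive_log u t : `|u| = 1 -> `|t| < 1 ->
  is_derive t (1 : R) (fun s => ln (`|qsum e (s *: u)| ^+ 2)) (logder u t).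
Proof.
move=> u1 t1; apply: is_derive_ln_comp; last exact: is_derive_qsum_sqnorm.
by rewrite exprn_gt0 // normr_gt0 nz // normrZ u1 mulr1.
Qed.

Lemma starlike_lower q : `|q| < 1 -> 1 / (1 + b * `|q| + `|q| ^+ 2) <= `|qsum e q|.
Proof.
move=> q1; have [u u1 qE] := unit_direction q; set r := `|q| in q1 qE *.
have r0 : 0 <= r by exact: normr_ge0.
pose X t := 1 + b * t + 1 * t ^+ 2.
have X0 t : 0 <= t -> 0 < X t.
  by move=> t0; rewrite /X; have := mulr_ge0 b0 t0; have := sqr_ge0 t; lra.
(* Logarithm of (|E| X)^2. For X = 1 + b t + t^2 one has 1 - t X'/X = (1 - t^2)/X, so the derivative
   is 2/t times the gap in [starlike_re_ge]. The literal factor 1 in [X] keeps the shape of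
   [is_derive_quadratic_poly]. *)
pose g t := ln (`|qsum e (t *: u)| ^+ 2) + 2 * ln (X t).
pose g' t := logder u t + 2 * ((b + 1 * (2 * t)) / X t).
have gd t : 0 <= t <= r -> is_derive t (1 : R) g (g' t).
  move=> /andP[t0 tr]; have t1 : `|t| < 1 by rewrite ger0_norm // (le_lt_trans tr).
  apply: is_deriveD; first exact: is_derive_log.
  apply: is_deriveZ; apply: is_derive_ln_comp; first exact: X0.
  exact: is_derive_quadratic_poly.
have g'0 t : 0 < t <= r -> 0 <= g' t.
  move=> /andP[t0 tr]; have t1 : t < 1 by apply: le_lt_trans tr q1.
  rewrite /g' logderE ?t0 //; have nt : `|t *: u| = t by rewrite normrZ u1 mulr1 gtr0_norm.
  have := @starlike_re_ge (t *: u); rewrite nt => /(_ t1); rewrite -/(rat u t).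
  have Xt := X0 t (ltW t0); rewrite -[t ^+ 2 in X in X <= _]mul1r -/(X t) => h.
  have -> : 2 * (rat u t - 1) / t + 2 * ((b + 1 * (2 * t)) / X t)
     = 2 / t * (rat u t - (1 - 1 * t ^+ 2) / X t).
    have Xn : 1 + b * t + t ^+ 2 != 0 by rewrite -[t ^+ 2]mul1r -/(X t) gt_eqF.
    by rewrite /X; field; rewrite Xn gt_eqF.
  by rewrite mulr_ge0 ?subr_ge0 // divr_ge0 // ltW.
have := mono_of_derive r0 gd g'0.
rewrite /g scale0r qsum0 e0 quat_norm1 expr1n ln1 /X mulr0 expr0n /= mulr0 !addr0 ln1 mulr0 addr0.
rewrite -/(X r) -qE.
have E0 : 0 < `|qsum e q| by rewrite normr_gt0 nz.
have Xr := X0 r r0; rewrite lnXn // mulr2n => h.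
rewrite -[r ^+ 2]mul1r -/(X r) ler_pdivrMr // -ler_ln ?posrE ?mulr_gt0 // ln1 lnM ?posrE //.
lra.
Qed.

Lemma starlike_upper q : `|q| < 1 ->
  `|qsum e q| <= 1 / (1 - `|q| ^+ 2) * ((1 + `|q|) / (1 - `|q|)) `^ (b / 2).
Proof.
move=> q1; have [u u1 qE] := unit_direction q; set r := `|q| in q1 qE *.
have r0 : 0 <= r by exact: normr_ge0.
pose X c k t : R := 1 + c * t + k * t ^+ 2.
(* Logarithm of ((1 + t)/(1 - t))^b / ((1 - t^2) |E|)^2, whose derivative is 2/t times the gap
   between (1 + b t + t^2)/(1 - t^2) and the real part. [X] covers 1 + t, 1 - t and 1 - t^2 at
   once. *)
pose g t := (b * ln (X 1 0 t) - b * ln (X (-1) 0 t)) - 2 * ln (X 0 (-1) t)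
   - ln (`|qsum e (t *: u)| ^+ 2).
pose g' t := (b * ((1 + 0 * (2 * t)) / X 1 0 t) - b * ((-1 + 0 * (2 * t)) / X (-1) 0 t))
   - 2 * ((0 + (-1) * (2 * t)) / X 0 (-1) t) - logder u t.
have X1 t : 0 <= t <= r -> [/\ 0 < X 1 0 t, 0 < X (-1) 0 t & 0 < X 0 (-1) t].
  move=> /andP[t0 tr]; have t1 : t < 1 by apply: le_lt_trans tr q1.
  have : t ^+ 2 < 1 by rewrite expr2 mulr_ilt1.
  by rewrite /X; split; lra.
have gd t : 0 <= t <= r -> is_derive t (1 : R) g (g' t).
  move=> tr; have [x1 x2 x3] := X1 t tr; move: tr => /andP[t0 tr].
  have t1 : `|t| < 1 by rewrite ger0_norm // (le_lt_trans tr).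
  apply: is_deriveB; last exact: is_derive_log.
  apply: is_deriveB; first apply: is_deriveB.
  - by apply: is_deriveZ; apply: is_derive_ln_comp x1 _; apply: is_derive_quadratic_poly.
  - by apply: is_deriveZ; apply: is_derive_ln_comp x2 _; apply: is_derive_quadratic_poly.
  - by apply: is_deriveZ; apply: is_derive_ln_comp x3 _; apply: is_derive_quadratic_poly.
have g'0 t : 0 < t <= r -> 0 <= g' t.
  move=> /andP[t0 tr]; have t1 : t < 1 by apply: le_lt_trans tr q1.
  have [|x1 x2 x3] := X1 t; first by rewrite ltW.
  rewrite /g' logderE ?t0 //; have nt : `|t *: u| = t by rewrite normrZ u1 mulr1 gtr0_norm.
  have := @starlike_norm_le (t *: u); rewrite nt => /(_ t1) h.
  have {}h := le_trans (le_trans (ler_norm _) (quat_re_norm _)) h; rewrite -/(rat u t) in h.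
  have d1 : 1 + t != 0 by rewrite gt_eqF // addr_gt0.
  have d2 : 1 - t != 0 by rewrite gt_eqF // subr_gt0.
  have d3 : 1 - t ^+ 2 != 0 by rewrite (_ : _ - _ = (1 - t) * (1 + t)) ?mulf_neq0 //; ring.
  rewrite (_ : _ - _ - _ = 2 / t * ((1 + b * t + t ^+ 2) / (1 - t ^+ 2) - rat u t)).
    by rewrite mulr_ge0 ?subr_ge0 // divr_ge0 // ltW.
  have -> : X 1 0 t = 1 + t by rewrite /X; ring.
  have -> : X (-1) 0 t = 1 - t by rewrite /X; ring.
  have -> : X 0 (-1) t = (1 - t) * (1 + t) by rewrite /X; ring.
  have -> : 1 - t ^+ 2 = (1 - t) * (1 + t) by ring.
  by field; rewrite d1 d2 gt_eqF.
have := mono_of_derive r0 gd g'0.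
have [|x1 x2 x3] := X1 r; first by rewrite r0 lexx.
have XE : X 1 0 r = 1 + r /\ X (-1) 0 r = 1 - r /\ X 0 (-1) r = 1 - r ^+ 2.
  by rewrite /X; split; [ring | split; ring].
have -> : g 0 = 0.
  rewrite /g scale0r qsum0 e0 quat_norm1 expr1n /X !mulr0 expr0n /= !mulr0 !addr0 ln1.
  by rewrite !mulr0 !subr0.
rewrite /g -qE; case: XE x1 x2 x3 => -> [-> ->] x1 x2 x3.
have E0 : 0 < `|qsum e q| by rewrite normr_gt0 nz.
rewrite lnXn // -[ln _ *+ 2]mulr_natl => h.
have Q0 : 0 < (1 + r) / (1 - r) by rewrite divr_gt0.
rewrite /powR gt_eqF // ln_div ?posrE // -ler_ln ?posrE ?mulr_gt0 ?divr_gt0 ?expR_gt0 //.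
rewrite lnM ?posrE ?divr_gt0 ?expR_gt0 // expRK ln_div ?posrE // ln1.
move: (ln (1 + r)) (ln (1 - r)) (ln (1 - r ^+ 2)) (ln _) h => l1 l2 l3 l4; lra.
by rewrite invr_gt0.
Qed.

End StarlikeGrowth.

(** * The theorem *)

Section Coefficients.
Variable R : realType.
Local Notation H := (quat R).
Variables (f : H -> H) (a : nat -> H).
Hypothesis fa : forall q : H, quat_ball q ->
    (fun N : nat => q + \sum_(2 <= n < N) q ^+ n * a n) @ \oo --> f q.
Implicit Types (q : H) (t : R).

(** Coefficients of E = f / q; its coefficient of index 1 is [a 2]. *)
Definition ratio_coef (n : nat) : H := if n is m.+1 then a n.+1 else 1.

Lemma psum_ratio_coef q N :
  q + \sum_(2 <= n < N.+2) q ^+ n * a n = q * psum ratio_coef q N.+1.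
Proof.
elim: N => [|N IH].
  by rewrite big_geq // addr0 /psum big_ord_recl big_ord0 addr0 /= !mulr1.
by rewrite big_nat_recr //= addrA IH [psum _ q N.+2]psumS mulrDr /= mulrA -exprS.
Qed.

Lemma cvg_ratio_coef q : q != 0 -> quat_ball q ->
  (fun N => psum ratio_coef q N.+1) @ \oo --> q^-1 * f q.
Proof.
move=> q0 qB; have h := fa qB; rewrite -(cvg_shiftn 2) in h.
have {}h := cvgn_quatM (x := q^-1) (y := 1) h.
rewrite mulr1 in h; apply: cvg_trans h; apply: near_eq_cvg; apply: nearW => N.
by rewrite /= mulr1 addn2 psum_ratio_coef mulKr.
Qed.

(** Abel's argument: convergence at the real point [t] bounds the terms there, since beyond [K] each
    is a difference of two partial sums within 1 of the limit. *)
Lemma pow_summable_ratio_coef : pow_summable ratio_coef.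
Proof.
apply: pow_summable_bounded => t t0 t1.
have nt : `|t%:A : H| = t by rewrite quat_norm_alg gtr0_norm.
have t0' : (t%:A : H) != 0 by rewrite -normr_eq0 nt gt_eqF.
have qB : quat_ball (t%:A : H) by rewrite /quat_ball /= nt.
have cv := cvg_ratio_coef t0' qB.
have /cvgrPdist_lt /(_ 1 ltr01) [K _ hK] := cv.
have S0 N : 0 <= \sum_(n < N) `|ratio_coef n| * t ^+ n.
  by apply: sumr_ge0 => n _; rewrite mulr_ge0 ?exprn_ge0 // ltW.
exists (2 + \sum_(n < K.+1) `|ratio_coef n| * t ^+ n) => n.
have [nK|] := ltnP n K.+1.
  rewrite (bigD1 (Ordinal nK)) //= addrCA lerDl addr_ge0 // sumr_ge0 // => i _.
  by rewrite mulr_ge0 ?exprn_ge0 // ltW.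
case: n => // n; rewrite ltnS => Kn.
apply: ler_wpDr => //.
have -> : `|ratio_coef n.+1| * t ^+ n.+1 = `|psum ratio_coef t%:A n.+2 - psum ratio_coef t%:A n.+1|.
  by rewrite [psum _ _ n.+2]psumS addrC addKr quat_normM quat_normX nt mulrC.
have h1 := hK n Kn; have h2 := hK n.+1 (leqW Kn); rewrite /= in h1 h2.
have := ler_normD (psum ratio_coef t%:A n.+2 - (t%:A)^-1 * f t%:A)
  ((t%:A)^-1 * f t%:A - psum ratio_coef t%:A n.+1).
rewrite addrA subrK => h; rewrite distrC in h2; lra.
Qed.

Lemma qsum_ratio_coef q : quat_ball q -> f q = q * qsum ratio_coef q.
Proof.
move=> qB; have [q0|q0] := eqVneq q 0.
  have h0 := fa qB; rewrite q0 in h0; rewrite q0 mul0r.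
  rewrite (_ : (fun N : nat => _) = fun=> 0) in h0; last first.
    apply/funext => N; rewrite add0r big_nat_cond big1 // => n /andP[/andP[n2 _] _].
    by rewrite expr0n gtn_eqF ?mul0r // (leq_trans _ n2).
  by rewrite -(cvg_lim (@norm_hausdorff _ _) h0) lim_cst.
have -> : qsum ratio_coef q = q^-1 * f q; last by rewrite mulVKr.
apply: qsum_unique; rewrite -(cvg_shiftS (psum _ q)); exact: cvg_ratio_coef.
Qed.

Lemma slice_deriv_ratio_coef q : slice_regular f -> quat_ball q ->
  slice_deriv f q = qsum (fun n => n.+1%:R *: ratio_coef n) q.
Proof.
move=> fr qB; rewrite /slice_deriv.
have IS := slice_unit_sphere q; have pE := slice_ptE q.
set I := slice_unit q in IS pE *; set x := quat_re q in pE *; set y := `|quat_im q| in pE *.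
have ptB : quat_ball (slice_pt I x y) by rewrite pE.
(* By the Cauchy-Riemann equation the slice derivative is the derivative in the real direction, and
   1 commutes with [q]. *)
rewrite (slice_regular_dx fr IS ptB) /slice_dx.
have es := pow_summable_ratio_coef.
(* The coefficients of f itself, indexed so that [dcoef e'] unfolds to the sequence in the
   statement. *)
pose e' n : H := if n is m.+1 then ratio_coef m else 0.
have e's : pow_summable e'.
  move=> t t0 t1; have [C hC] := es t t0 t1; exists C => -[|N].
    by rewrite big_ord0; have := hC 0%N; rewrite big_ord0.
  rewrite big_ord_recl /= normr0 mul0r add0r; apply: le_trans (hC N).
  apply: ler_sum => i _; rewrite /bump /= add1n exprS mulrCA ler_piMl ?(ltW t1) //.
  by rewrite mulr_ge0 ?exprn_ge0 // ltW.
have fE p : quat_ball p -> f p = qsum e' p.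
  by move=> pB; rewrite qsum_ratio_coef // -qsum_shift.
have c1 : q * 1 = 1 * q by rewrite mulr1 mul1r.
have n1 : `|1 : H| <= 1 by rewrite quat_norm1.
have [C [del [del0 hC]]] := qsum_dir_quadratic e's qB n1 c1.
have qd : 0 < 1 - `|q| by rewrite subr_gt0.
rewrite derive1E; apply: derive_val.
(* The cap 1 - |q| keeps q + u in the ball, where f is given by its series. *)
apply: (@is_derive_quadratic R _ _ _ _ C (Num.min del (1 - `|q|))).
  by rewrite lt_min del0 qd.
move=> u; rewrite lt_min => /andP[ud uq].
have -> : slice_pt I (u + x) y = q + u *: 1.
  by rewrite -[in RHS]pE /slice_pt scalerDl -addrA addrC.
rewrite pE !fE //; last first.
  rewrite /quat_ball /=; apply: le_lt_trans (ler_normD _ _) _.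
  by rewrite quat_norm_alg addrC -ltrBrDr.
by have := hC u ud; rewrite mul1r.
Qed.

End Coefficients.

Theorem theorem5p2 (R : realType) (f : quat R -> quat R) (a : nat -> quat R)
  (fS : slice_starlike f)
  (fa : forall q : quat R, quat_ball q ->
    (fun N : nat => q + \sum_(2 <= n < N) q ^+ n * a n) @ \oo --> f q)
  (q : quat R) (qB : quat_ball q) :
  [/\ `|q| / (1 + `|a 2%N * q| + `|q| ^+ 2) <= `|f q|
        <= `|q| / (1 - `|q| ^+ 2)
           * ((1 + `|q|) / (1 - `|q|)) `^ (`|a 2%N| / 2),
      (1 - `|q| ^+ 2) / (1 + `|a 2%N * q| + `|q| ^+ 2) ^+ 2
        <= `|slice_deriv f q|
        <= (1 + `|a 2%N * q| + `|q| ^+ 2) / (1 - `|q| ^+ 2) ^+ 2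
           * ((1 + `|q|) / (1 - `|q|)) `^ (`|a 2%N| / 2) &
      (1 - `|q| ^+ 2) / (1 + `|a 2%N * q| + `|q| ^+ 2)
        <= starlike_norm_quot f q
        <= (1 + `|a 2%N * q| + `|q| ^+ 2) / (1 - `|q| ^+ 2)].
Proof.
have [[fr fz _] fpos] := fS.
pose e := ratio_coef a; pose d n : quat R := n.+1%:R *: e n.
have es : pow_summable e by exact: pow_summable_ratio_coef fa.
have fE p : `|p| < 1 -> f p = p * qsum e p by exact: qsum_ratio_coef.
have dE p : `|p| < 1 -> slice_deriv f p = qsum d p.
  by move=> pB; apply: slice_deriv_ratio_coef.
have nz p : `|p| < 1 -> qsum e p != 0.
  move=> pB; have [->|p0] := eqVneq p 0; first by rewrite qsum0 oner_neq0.
  apply/eqP => E0; have : [set q | quat_ball q /\ f q = 0] p.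
    by split => //; rewrite fE // E0 mulr0.
  by rewrite fz /=; apply/eqP.
have e0 : e 0%N = 1 by [].
have quotE p : `|p| < 1 -> starlike_quot f p = (qsum e p)^-1 * qsum d p.
  move=> pB; rewrite /starlike_quot; case: eqVneq => [->|p0].
    by rewrite !qsum0 /d scale1r e0 invr1 mulr1.
  (* Inversion reverses factors, so (qE)^-1 q = E^-1 q^-1 q = E^-1. *)
  by rewrite fE // dE // invrM ?quat_unitE ?nz // -!mulrA mulKr.
have pos p : `|p| < 1 -> 0 < quat_re ((qsum e p)^-1 * qsum d p).
  by move=> pB; rewrite -quotE //; apply: fpos.
have q1 : `|q| < 1 by [].
have -> : `|a 2%N * q| = `|e 1%N| * `|q| by rewrite quat_normM.
rewrite -[`|a 2%N|]/(`|e 1%N|).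
have Plo := le_trans (starlike_re_ge es e0 nz pos q1) (le_trans (ler_norm _) (quat_re_norm _)).
have Pup := starlike_norm_le es e0 nz pos q1.
have Elo := starlike_lower es e0 nz pos q1.
have Eup := starlike_upper es e0 nz pos q1.
rewrite -/(d) in Plo Pup.
have normE : starlike_norm_quot f q = `|(qsum e q)^-1 * qsum d q|.
  rewrite -quotE // /starlike_norm_quot /starlike_quot; case: eqVneq => [_|_].
    by rewrite quat_norm1.
  by rewrite -mulrA [in RHS]quat_normM quat_normV mulrC.
(* The bounds on f' are the products of those on |E| and on |E^-1 D|. *)
have DE : `|slice_deriv f q| = `|qsum e q| * `|(qsum e q)^-1 * qsum d q|.
  by rewrite dE // -quat_normM mulVKr // quat_unitE nz.
rewrite normE DE fE // quat_normM.
move: Plo Pup Elo Eup; set P := `|_ * qsum d q|; set E := `|qsum e q|.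
set b := `|e 1%N|; set r := `|q|; set X := 1 + b * r + r ^+ 2; set W := _ `^ _.
move=> Plo Pup Elo Eup.
have r0 : 0 <= r by exact: normr_ge0.
have X0 : 0 < X.
  by rewrite /X; have := mulr_ge0 (normr_ge0 (e 1%N)) r0; have := sqr_ge0 r; rewrite -/b; lra.
have Y0 : 0 < 1 - r ^+ 2 by rewrite subr_gt0 expr2 mulr_ilt1.
have P0 : 0 <= P by exact: normr_ge0.
have E0 : 0 <= E by exact: normr_ge0.
split; last by rewrite Plo.
- apply/andP; split; first by rewrite ler_wpM2l // -[X^-1]mul1r.
  by rewrite -mulrA ler_wpM2l // -[(1 - r ^+ 2)^-1]mul1r.
- apply/andP; split.
    rewrite (_ : (1 - r ^+ 2) / X ^+ 2 = 1 / X * ((1 - r ^+ 2) / X)).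
      by apply: ler_pM => //; apply: divr_ge0 => //; apply: ltW.
    by field; rewrite gt_eqF.
  rewrite (_ : X / _ * _ = 1 / (1 - r ^+ 2) * W * (X / (1 - r ^+ 2))).
    by apply: ler_pM.
  by field; rewrite gt_eqF.
Qed.
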